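(* Let $T>0$ and let $\mathbf{X}=(X(t),t\in\mathbb{R})$ be a time reversible stationary process with upper semi-continuous sample paths satisfying Assumption $\mathrm{U}_T$. Then the density $f_{\mathbf{X},T}$ of the unique location of the supremum in the interval $[0,T]$ satisfies, for $0<t<T$, $$f_{\mathbf{X},T}(t)\le B_T(t):=\begin{cases}\dfrac1{2t},&0<t\le\frac T3,\\[4pt]\dfrac1{T-t},&\frac T3<t\le\frac T2,\\[4pt]\dfrac1t,&\frac T2<t\le\frac{2T}3,\\[4pt]\dfrac1{2(T-t)},&\frac{2T}3<t<T.\end{cases}$$ Furthermore, for each $0<t<T$ and every real number $c<B_T(t)$ there is a sample continuous stationary Gaussian process $\mathbf{X}$ satisfying Assumptions $\mathrm{U}_T$ and L for which $f_{\mathbf{X},T}(t)>c$.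
   Context: All processes are real-valued and defined on a probability space. Stationarity is understood at the level of sample paths: for all compact intervals $[a_i,b_i]$ with $a_i\le b_i$, $i=1,\dots,n$, the suprema $\sup_{a_i\le s\le b_i}X(s)$ are random variables, and the joint law of $\bigl(\sup_{a_i+h\le s\le b_i+h}X(s)\bigr)_{i=1}^n$ does not depend on $h\in\mathbb{R}$ (for sample continuous processes this is equivalent to shift-invariance of the finite-dimensional distributions). Time reversible means that $(X(-t),t\in\mathbb{R})$ has the same law as $(X(t),t\in\mathbb{R})$, in the same sense (equality of the joint laws of suprema over finitely many compact intervals). $\tau_{\mathbf{X},T}=\min\{t\in[0,T]: X(t)=\sup_{0\le s\le T}X(s)\}$ is the (leftmost) location of the supremum in $[0,T]$, and $F_{\mathbf{X},T}$ is its law. For every stationary process with upper semi-continuous sample paths, the restriction of $F_{\mathbf{X},T}$ to $(0,T)$ is absolutely continuous, the cumulative distribution function of $F_{\mathbf{X},T}$ has a right derivative at every point of $(0,T)$, and $f_{\mathbf{X},T}$ denotes the version of the density on $(0,T)$ given by this right derivative; it is right continuous with left limits. Assumption $\mathrm{U}_T$: with probability $1$ there is only one point of $[0,T]$ at which $X$ attains $\sup_{0\le s\le T}X(s)$ (so $\tau_{\mathbf{X},T}$ is the unique location). Assumption L: $\lim_{\varepsilon\downarrow0}\frac1\varepsilon P(\mathbf{X}\text{ has a local maximum in }(0,\varepsilon))<\infty$ (the limit always exists in $[0,\infty]$). A local maximum is a point $u$ with $X(s)\le X(u)$ for all $s$ in some neighbourhood of $u$ (not necessarily strict). *)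

(* Defs.v *)
From HB Require Import structures.
From mathcomp Require Import all_boot all_order all_algebra.
From mathcomp Require Import all_classical all_reals all_analysis.

Set Implicit Arguments.
Unset Strict Implicit.
Unset Printing Implicit Defensive.

Import Order.TTheory GRing.Theory Num.Theory.
Import numFieldNormedType.Exports.

Local Open Scope classical_set_scope.
Local Open Scope ring_scope.

Section Process.
Context (d : measure_display) (Omega : measurableType d) (R : realType).
Variable P : probability Omega R.
Implicit Type X : R -> Omega -> R.

Definition same_law (d' : measure_display) (S : measurableType d')
    (Y Z : Omega -> S) : Prop :=
  forall A : set S, measurable A -> pushforward P Y A = pushforward P Z A.

(* [sup] takes values in R; the supremum over a compact interval is finite, and
   attained, as soon as the path is upper semi-continuous. *)
Definition path_sup X (a b : R) (w : Omega) : R :=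
  sup [set X s w | s in `[a, b]].

Definition path_sups X (n : nat) (a b : 'I_n -> R) (w : Omega) : n.-tuple R :=
  [tuple path_sup X (a i) (b i) w | i < n].

Definition stationary X : Prop :=
  (forall a b : R, a <= b -> measurable_fun setT (path_sup X a b)) /\
  (forall (n : nat) (a b : 'I_n -> R) (h : R), (forall i, a i <= b i) ->
     same_law (path_sups X (fun i => a i + h) (fun i => b i + h))
              (path_sups X a b)).

Definition time_reversible X : Prop :=
  forall (n : nat) (a b : 'I_n -> R), (forall i, a i <= b i) ->
    same_law (path_sups (fun t => X (- t)) a b) (path_sups X a b).

Definition usc_paths X : Prop :=
  forall w, lower_semicontinuous (fun t : R => (- X t w)%:E).

Definition continuous_paths X : Prop :=
  forall w, continuous (fun t : R => X t w).

Definition sup_locations X (T : R) (w : Omega) : set R :=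
  [set t | 0 <= t <= T /\ X t w = path_sup X 0 T w].

(* For upper semi-continuous paths [sup_locations X T w] is compact and
   nonempty, so its infimum is its least element. *)
Definition sup_location X (T : R) (w : Omega) : R := inf (sup_locations X T w).

Definition unique_sup_location X (T : R) : Prop :=
  {ae P, forall w, exists! t, sup_locations X T w t}.

Definition sup_location_cdf X (T t : R) : R :=
  fine (pushforward P (sup_location X T) `]-oo, t]).

Definition cdf_quotient X (T t h : R) : R :=
  h^-1 * (sup_location_cdf X T (t + h) - sup_location_cdf X T t).

(* [lim] has a default value for divergent filters; [has_sup_density] says that
   the right derivative defining [sup_density] really exists on (0, T). *)
Definition has_sup_density X (T : R) : Prop :=
  forall t, 0 < t < T -> cvg (cdf_quotient X T t h @[h --> 0^'+]).

Definition sup_density X (T t : R) : R :=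
  lim (cdf_quotient X T t h @[h --> 0^'+]).

Definition local_max_in X (a b : R) (w : Omega) : Prop :=
  exists2 u : R, a < u < b & \forall s \near u, X s w <= X u w.

Definition finite_local_max_rate X : Prop :=
  exists l : R,
    ((e^-1)%:E * P [set w | local_max_in X 0 e w])%E @[e --> 0^'+] --> l%:E.

(* Normal law of mean [m] and variance [s ^+ 2]; for [s = 0] the library's
   [normal_prob m s] is the uniform law on [0, 1], not the Dirac mass at [m]. *)
Definition gaussian_law (m s : R) (A : set R) : \bar R :=
  if s == 0 then \d_m A else normal_prob m s A.

(* The finite-dimensional laws are multivariate normal, possibly degenerate:
   every linear combination of coordinates has a normal law. *)
Definition gaussian_process X : Prop :=
  (forall t, measurable_fun setT (X t)) /\
  (forall (n : nat) (t c : 'I_n -> R), exists m s : R, 0 <= s /\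
     forall A : set R, measurable A ->
       pushforward P (fun w => \sum_(i < n) c i * X (t i) w) A
         = gaussian_law m s A).

End Process.

Definition density_bound (R : realType) (T t : R) : R :=
  if t <= T / 3 then (2 * t)^-1
  else if t <= T / 2 then (T - t)^-1
  else if t <= 2 * T / 3 then t^-1
  else (2 * (T - t))^-1.

(* Main.v *)
(* Stationarity turns the law of the location of the supremum into a statement
   about one window: the mass of (t, t + h] is the probability p(t, h, T - t)
   that X strictly exceeds on a window of length h everything it does during the
   time t before it, and is not exceeded during the remaining time after it.
   This quantity is monotone and supermodular in the two outer lengths and
   subadditive in the window, whence the existence of the limit of
   p(t, h, T - t) / h.

   Upper bound. Reversibility and uniqueness make the density symmetric about
   T / 2. Place disjoint windows of length h along the line and mark those that
   are peaks over (t, T - t) and those that are peaks over (T - t, t). Two marks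
   at a distance smaller than the lengths over which they dominate exclude each
   other, so the number of marks per unit of time is bounded; taking
   expectations bounds the density.

   Sharpness. Let X be the sum of a random sinusoid of period p and of a
   sinusoid of the same kind whose amplitude and frequency are tiny. The first
   one attains its maximum uniformly over a period. If p is slightly larger than
   max(t, T - t), a peak at t beats everything in the interval, which gives a
   density close to 1 / p. If p is only slightly larger than min(t, T - t), the
   peaks at distance a multiple of p compete on one side, and the slow sinusoid,
   which is monotone over the interval, decides in favour of the right one with
   probability 1 / 2: the density is close to 1 / (2 p). *)
Require Import Defs.
From HB Require Import structures.
From mathcomp Require Import all_boot all_order all_algebra.
From mathcomp Require Import all_classical all_reals all_analysis.
From mathcomp Require Import measurable_realfun ring lra.

Set Implicit Arguments.
Unset Strict Implicit.
Unset Printing Implicit Defensive.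

Import Order.TTheory GRing.Theory Num.Theory.
Import numFieldNormedType.Exports.

Local Open Scope classical_set_scope.
Local Open Scope ring_scope.

(** The bound is the reciprocal of min(max(t, T - t), 2 min(t, T - t)). Marks of one kind may be as
    close as the shorter dominated length, but in one of the two mixed orders the marks face each
    other with their longer sides and need a longer gap; counting both kinds together is what
    improves on 1 / min(t, T - t). Reversal turns leftmost locations into rightmost ones, and
    uniqueness turns them back.

    The obstacle to the limit is that cutting a window also changes the outer lengths of its pieces,
    so the quotient itself is not monotone. Adding the window to the right length makes it monotone
    under halving; the rates obtained in this way enclose the quotient at slightly perturbed outer
    lengths, and supermodularity closes the gap.

    The same monotonicity bounds the density from below by the quotient of any single window. For
    sharpness a window is therefore fixed first and the slow sinusoid is made small afterwards, with
    no interchange of limits. The slow sinusoid also provides uniqueness: a pure sinusoid repeats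
    its maximum in intervals longer than its period. *)

Section SegmentSup.
Context {R : realType}.
Implicit Types (f g : R -> R) (a b c s t : R).

Definition seg_sup f a b : R := sup [set f s | s in `[a, b]].

Definition usc f : Prop := lower_semicontinuous (fun t : R => (- f t)%:E).

Lemma usc_near f s c : usc f -> f s < c -> \forall t \near s, f t < c.
Proof.
move=> uf fsc; have [|V Vs fV] := uf s (- c).
  by rewrite lte_fin ltrN2.
by apply: filterS Vs => t /fV; rewrite lte_fin ltrN2.
Qed.

Lemma continuous_usc f : continuous f -> usc f.
Proof.
move=> cf s a; rewrite lte_fin ltrNr => fa.
exists [set t | f t < - a]; last by move=> t; rewrite /= lte_fin ltrNr.
have /cvgr_lt := cf s; exact.
Qed.

(** Without a maximum the open sets [f < f t] would cover the segment; the centre of a finite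
    subcover with the largest value lies in none of its members. *)
Lemma usc_max f a b : usc f -> a <= b ->
  exists2 s, a <= s <= b & forall t, a <= t <= b -> f t <= f s.
Proof.
move=> uf ab; apply: contrapT => nomax.
have grow s : a <= s <= b -> exists2 t, a <= t <= b & f s < f t.
  move=> sab; apply: contrapT => nt; apply: nomax; exists s => // t tab.
  by rewrite leNgt; apply/negP => ft; apply: nt; exists t.
have := @segment_compact R a b; rewrite compact_cover => cpt.
have [||D Dab cov] := cpt R `[a, b]%classic (fun t => [set s | f s < f t]).
- by move=> t _; rewrite openE /= => s /= st; exact: usc_near.
+ move=> s /=; rewrite in_itv/= => /grow[t tab st]; exists t => //.
have mx (r : seq R) : (forall z, z \in r -> a <= z <= b) -> exists2 m : R, a <= m <= b &
    forall t, t \in r -> f t <= f m.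
  elim: r => [_|x r IH sub]; first by exists a => //; rewrite lexx.
  have [|m mab mP] := IH; first by move=> z zr; apply: sub; rewrite inE zr orbT.
  have xab : a <= x <= b by apply: sub; rewrite inE eqxx.
  have [fx|fx] := leP (f x) (f m).
    by exists m => // t; rewrite inE => /orP[/eqP->//|/mP].
  exists x => // t; rewrite inE => /orP[/eqP->//|/mP ftm].
  exact: le_trans ftm (ltW fx).
have [|m mab mP] := mx (finmap.enum_fset D).
  by move=> z zD; have := Dab z zD; rewrite inE/= in_itv.
have [|t tD /=] := cov m; first by rewrite /= in_itv.
by apply/negP; rewrite -leNgt mP.
Qed.

Section Usc.
Variables (f : R -> R) (uf : usc f).

Lemma seg_sup_has a b : a <= b -> has_sup [set f s | s in `[a, b]].
Proof.
move=> ab; have [s sab sP] := usc_max uf ab; split.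
  by exists (f s); exists s => //; rewrite /= in_itv.
by exists (f s) => _ [t + <-]; rewrite /= in_itv/= => /sP.
Qed.

Lemma seg_sup_ub a b t : a <= t <= b -> f t <= seg_sup f a b.
Proof.
move=> /andP[at_ tb]; apply: (sup_upper_bound (seg_sup_has (le_trans at_ tb))).
by exists t; rewrite //= in_itv/= at_.
Qed.

Lemma seg_sup_attained a b : a <= b ->
  exists2 s, a <= s <= b & f s = seg_sup f a b.
Proof.
move=> ab; have [s sab sP] := usc_max uf ab; exists s => //.
apply/eqP; rewrite eq_le seg_sup_ub//=; apply: ge_sup.
  by exists (f s); exists s => //; rewrite /= in_itv.
by move=> _ [t + <-]; rewrite /= in_itv/= => /sP.
Qed.

Lemma seg_sup_leP a b c : a <= b ->
  (seg_sup f a b <= c) <-> (forall t, a <= t <= b -> f t <= c).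
Proof.
move=> ab; split=> [fc t tab|fc].
  exact: le_trans (seg_sup_ub tab) fc.
by have [s sab <-] := seg_sup_attained ab; exact: fc.
Qed.

Lemma seg_sup_ltP a b c : a <= b ->
  (seg_sup f a b < c) <-> (forall t, a <= t <= b -> f t < c).
Proof.
move=> ab; split=> [fc t tab|fc].
  exact: le_lt_trans (seg_sup_ub tab) fc.
by have [s sab <-] := seg_sup_attained ab; exact: fc.
Qed.

Lemma seg_sup_sub a' b' a b : a' <= a -> a <= b -> b <= b' ->
  seg_sup f a b <= seg_sup f a' b'.
Proof.
move=> aa ab bb; apply/seg_sup_leP => // t tab; apply: seg_sup_ub; lra.
Qed.

Lemma seg_sup_cat a b c : a <= b -> b <= c ->
  seg_sup f a c = Num.max (seg_sup f a b) (seg_sup f b c).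
Proof.
move=> ab bc; apply/eqP; rewrite eq_le; apply/andP; split.
  apply/seg_sup_leP; first exact: le_trans bc.
  move=> t tac; rewrite le_max; have [tb|tb] := leP t b.
    by rewrite seg_sup_ub//; lra.
  by rewrite (@seg_sup_ub b) ?orbT//; lra.
by rewrite ge_max !seg_sup_sub.
Qed.

End Usc.

Lemma seg_sup_comp f (h : R -> R) a b a' b' :
  h @` `[a, b] = `[a', b']%classic -> seg_sup (f \o h) a b = seg_sup f a' b'.
Proof. by rewrite /seg_sup => <-; rewrite image_comp. Qed.

Lemma seg_sup_shift f h a b :
  seg_sup (fun s => f (s + h)) a b = seg_sup f (a + h) (b + h).
Proof.
rewrite (@seg_sup_comp f (fun s => s + h) a b (a + h) (b + h))//.
apply/seteqP; split => [_ [s + <-]|s]; rewrite /= !in_itv/=; first lra.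
by move=> sab; exists (s - h); rewrite /= ?in_itv/=; lra.
Qed.

Lemma seg_sup_opp f a b :
  seg_sup (fun s => f (- s)) a b = seg_sup f (- b) (- a).
Proof.
rewrite (@seg_sup_comp f -%R a b (- b) (- a))//.
apply/seteqP; split => [_ [s + <-]|s]; rewrite /= !in_itv/=; first lra.
by move=> sab; exists (- s); rewrite /= ?in_itv/= ?opprK//; lra.
Qed.

End SegmentSup.

(** * Real-valued probabilities and a first-moment bound *)

Section Prob.
Context (d : measure_display) (Omega : measurableType d) (R : realType).
Variable P : probability Omega R.
Implicit Types A B : set Omega.

Definition pr A : R := fine (P A).

Lemma prE A : measurable A -> P A = (pr A)%:E.
Proof. by move=> mA; rewrite fineK// fin_num_measure. Qed.

Lemma pr_ge0 A : 0 <= pr A.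
Proof. exact: fine_ge0. Qed.

Lemma pr_le A B : measurable A -> measurable B -> A `<=` B -> pr A <= pr B.
Proof.
by move=> mA mB AB; rewrite -lee_fin -!prE//; apply: le_measure; rewrite ?inE.
Qed.

Lemma pr_setT : pr setT = 1.
Proof. by rewrite /pr probability_setT. Qed.

Lemma prU A B : measurable A -> measurable B -> [disjoint A & B] ->
  pr (A `|` B) = pr A + pr B.
Proof.
move=> mA mB /disj_setPS AB0; apply: EFin_inj; rewrite EFinD -!prE//.
  by rewrite measureU//; apply/seteqP; split=> // x /AB0.
exact: measurableU.
Qed.

Lemma prU_le A B : measurable A -> measurable B ->
  pr (A `|` B) <= pr A + pr B.
Proof.
move=> mA mB; rewrite -lee_fin EFinD -!prE//; last exact: measurableU.
exact: measureU2.
Qed.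

Lemma prD A B : measurable A -> measurable B -> B `<=` A ->
  pr (A `\` B) = pr A - pr B.
Proof.
move=> mA mB BA; apply/eqP; rewrite -(inj_eq (addIr (pr B))) subrK; apply/eqP.
rewrite -prU//.
- by rewrite setDKU.
- exact: measurableD.
- by apply/disj_setPS => x [[]].
Qed.

Lemma pr_setI_null A Z N : measurable A -> measurable Z -> measurable N ->
  ~` N `<=` Z -> pr Z = 0 -> pr A <= pr (A `&` N).
Proof.
move=> mA mZ mN NZ Z0; have mAN : measurable (A `&` N) by exact: measurableI.
rewrite -[leRHS]addr0 -Z0; apply: le_trans (prU_le mAN mZ).
apply: pr_le => //; first exact: measurableU.
by move=> w Aw; have [Nw|Nw] := pselect (N w); [left|right; exact: NZ].
Qed.

(** Expectation of a pathwise count: exclusions between events become an inequality between their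
    probabilities. *)
Lemma sum_pr_le n (A B : nat -> set Omega) (K : R) :
  (forall k, measurable (A k)) -> (forall k, measurable (B k)) ->
  (forall w, \sum_(k < n) (\1_(A k) w + \1_(B k) w) <= K) ->
  \sum_(k < n) (pr (A k) + pr (B k)) <= K.
Proof.
move=> mA mB le_K; rewrite -lee_fin.
have -> : K%:E = (\int[P]_w K%:E)%E.
  by rewrite integral_cst//= probability_setT mule1.
have -> : (\sum_(k < n) (pr (A k) + pr (B k)))%:E =
    (\int[P]_w (\sum_(k < n) (\1_(A k) w + \1_(B k) w))%:E)%E.
  under [RHS]eq_integral do rewrite -sumEFin.
  rewrite ge0_integral_sum//.
  - rewrite -sumEFin; apply: eq_bigr => k _.
    under [RHS]eq_integral do rewrite EFinD.
    rewrite ge0_integralD//;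
      [|by apply/measurable_EFinP; exact: measurable_indic..].
    by rewrite !integral_indic// !setIT EFinD -!prE.
  - move=> k; apply/measurable_EFinP/measurable_funD; exact: measurable_indic.
apply: ge0_le_integral => //.
- by move=> w _; rewrite lee_fin sumr_ge0// => k _; rewrite addr_ge0.
- apply/measurable_EFinP/measurable_sum => k.
  by apply: measurable_funD; exact: measurable_indic.
- by move=> w _; rewrite lee_fin.
Qed.

End Prob.

(** * Combinatorics of two kinds of marks on a line *)

Section CountMarks.
Context {R : realFieldType}.

(* Invariant: after a mark of type [b] at [m] the count is at most
   [m * eta + c / 2], and after one of type [r] it is at most [m * eta + c]
   (in units of [c / 2]); so a [b] following an [r] must pay for the
   [r] as well, which is what the longer gap allows. *)
Lemma count_marks (r b : nat -> bool) (eta c : R) : 0 <= eta -> 0 <= c ->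
  (forall j k, (j < k)%N -> r j -> r k -> c / 2 <= (k - j)%:R * eta) ->
  (forall j k, (j < k)%N -> b j -> b k -> c / 2 <= (k - j)%:R * eta) ->
  (forall j k, (j < k)%N -> r j -> b k -> c <= (k - j)%:R * eta) ->
  forall n, c / 2 * (\sum_(k < n) ((r k)%:R + (b k)%:R)) <= n%:R * eta + c.
Proof.
move=> eta0 c0 rr bb rb n.
pose S n := \sum_(k < n) ((r k)%:R + (b k)%:R : R).
have SS m : S m.+1 = S m + (r m)%:R + (b m)%:R by rewrite /S big_ord_recr/= addrA.
pose Q n := c / 2 * S n <= 0 \/
  exists2 m, (m < n)%N &
    (r m /\ c / 2 * S n <= m%:R * eta + c) \/
    (b m /\ ~~ r m /\ c / 2 * S n <= m%:R * eta + c / 2).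
have natB j k : (j < k)%N -> (k - j)%:R * eta = k%:R * eta - j%:R * eta :> R.
  by move=> jk; rewrite natrB 1?ltnW// mulrBl.
have step m : Q m -> Q m.+1.
  rewrite /Q SS => H.
  have m0 : 0 <= m%:R * eta by rewrite mulr_ge0.
  case rm : (r m); case bm : (b m); rewrite /= ?addr0; last first.
  - case: H => [|[j jm Hj]]; [by left|right; exists j => //; exact: ltnW].
  - right; exists m => //; right; rewrite bm rm; split=> //; split=> //.
    case: H => [|[j jm [[rj Hj]|[bj [_ Hj]]]]]; first lra.
      by have := rb j m jm rj bm; rewrite natB//; lra.
    by have := bb j m jm bj bm; rewrite natB//; lra.
  - right; exists m => //; left; rewrite rm; split=> //.
    case: H => [|[j jm [[rj Hj]|[bj [_ Hj]]]]]; first lra.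
      by have := rr j m jm rj rm; rewrite natB//; lra.
    have : j%:R * eta <= m%:R * eta by rewrite ler_wpM2r// ler_nat ltnW.
    lra.
  - right; exists m => //; left; rewrite rm; split=> //.
    case: H => [|[j jm [[rj Hj]|[bj [_ Hj]]]]]; first lra.
      by have := rb j m jm rj bm; rewrite natB//; lra.
    by have := bb j m jm bj bm; rewrite natB//; lra.
have : Q n.
  elim: n => [|m]; last exact: step.
  by left; rewrite /S big_ord0 mulr0.
have n0 : 0 <= n%:R * eta by rewrite mulr_ge0.
case=> [|[m mn]]; first by rewrite -/(S n); lra.
have : m%:R * eta <= n%:R * eta by rewrite ler_wpM2r// ler_nat ltnW.
by rewrite -/(S n); move=> mn' [[_]|[_ [_]]]; lra.
Qed.

End CountMarks.

Section CompareSets.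
Context (d : measure_display) (T : measurableType d) (R : realType).
Variables f g : T -> R.
Hypotheses (mf : measurable_fun setT f) (mg : measurable_fun setT g).

Lemma measurable_lt_set : measurable [set x | f x < g x].
Proof.
have -> : [set x | f x < g x] = (fun x => g x - f x) @^-1` `]0, +oo[.
  by apply/seteqP; split=> x /=; rewrite in_itv/= andbT subr_gt0.
by rewrite -[X in measurable X]setTI; apply: measurable_funB.
Qed.

Lemma measurable_le_set : measurable [set x | f x <= g x].
Proof.
have -> : [set x | f x <= g x] = (fun x => g x - f x) @^-1` `[0, +oo[.
  by apply/seteqP; split=> x /=; rewrite in_itv/= andbT subr_ge0.
by rewrite -[X in measurable X]setTI; apply: measurable_funB.
Qed.

End CompareSets.

(** * Peak events of a window and their symmetries *)

Section LeftmostPeak.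
Context (d : measure_display) (Omega : measurableType d) (R : realType).
Variable P : probability Omega R.
Implicit Type X : R -> Omega -> R.

(** For upper semi-continuous paths: the leftmost location of the supremum over [[p, q]] lies in
    []s, s']]. The strict comparison is the one on the left. *)
Definition left_in X p s s' q : set Omega :=
  [set w | path_sup X p s w < path_sup X s s' w /\
           path_sup X s' q w <= path_sup X s s' w].

(** The mirror image: the rightmost location lies in [[s, s'[]. *)
Definition right_in X p s s' q : set Omega :=
  [set w | path_sup X s' q w < path_sup X s s' w /\
           path_sup X p s w <= path_sup X s s' w].

(** Both events are preimages of this one Borel set under a triple of suprema, the form in which
    stationarity and reversibility are stated. For [right_in] the triple is listed from right to
    left. *)
Definition mid_peak : set (3.-tuple R) :=
  [set x | tnth x 0 < tnth x 1 /\ tnth x 2%:R <= tnth x 1].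

Lemma measurable_mid_peak : measurable mid_peak.
Proof.
rewrite /mid_peak; apply: measurableI.
  by apply: measurable_lt_set; exact: measurable_tnth.
by apply: measurable_le_set; exact: measurable_tnth.
Qed.

Lemma left_inE X p s s' q : left_in X p s s' q =
  path_sups X (fun i : 'I_3 => nth 0 [:: p; s; s'] i)
              (fun i : 'I_3 => nth 0 [:: s; s'; q] i) @^-1` mid_peak.
Proof. by apply/seteqP; split=> w; rewrite /mid_peak /path_sups /preimage /mkset !tnth_mktuple. Qed.

Lemma right_inE X p s s' q : right_in X p s s' q =
  path_sups X (fun i : 'I_3 => nth 0 [:: s'; s; p] i)
              (fun i : 'I_3 => nth 0 [:: q; s'; s] i) @^-1` mid_peak.
Proof. by apply/seteqP; split=> w; rewrite /mid_peak /path_sups /preimage /mkset !tnth_mktuple. Qed.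

Lemma left_in_reversed X p s s' q : left_in (fun t => X (- t)) p s s' q =
  right_in X (- q) (- s') (- s) (- p).
Proof.
have E a b w : path_sup (fun t => X (- t)) a b w = path_sup X (- b) (- a) w.
  exact: (seg_sup_opp (X^~ w)).
by rewrite /left_in /right_in; apply/seteqP; split=> w /=; rewrite !E.
Qed.

Section Stationary.
Variables (X : R -> Omega -> R) (stX : stationary P X).

Lemma measurable_path_sup a b : a <= b -> measurable_fun setT (path_sup X a b).
Proof. exact: (proj1 stX). Qed.

Lemma measurable_left_in p s s' q : p <= s -> s <= s' -> s' <= q ->
  measurable (left_in X p s s' q).
Proof.
move=> ps ss sq; apply: measurableI.
  by apply: measurable_lt_set; exact: measurable_path_sup.
by apply: measurable_le_set; exact: measurable_path_sup.
Qed.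

Lemma measurable_right_in p s s' q : p <= s -> s <= s' -> s' <= q ->
  measurable (right_in X p s s' q).
Proof.
move=> ps ss sq; apply: measurableI.
  by apply: measurable_lt_set; exact: measurable_path_sup.
by apply: measurable_le_set; exact: measurable_path_sup.
Qed.

Let shift3 (a b : 'I_3 -> R) h : (forall i, a i <= b i) ->
  P (path_sups X (fun i => a i + h) (fun i => b i + h) @^-1` mid_peak) =
  P (path_sups X a b @^-1` mid_peak).
Proof. by move=> ab; apply: (proj2 stX) => //; exact: measurable_mid_peak. Qed.

Let nth3D (x y z h : R) : (fun i : 'I_3 => nth 0 [:: x + h; y + h; z + h] i) =
  (fun i : 'I_3 => nth 0 [:: x; y; z] i + h).
Proof. by apply/funext => -[[|[|[|?]]]]. Qed.

Lemma pr_left_in_shift h p s s' q : p <= s -> s <= s' -> s' <= q ->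
  pr P (left_in X (p + h) (s + h) (s' + h) (q + h)) = pr P (left_in X p s s' q).
Proof.
move=> ps ss sq; rewrite /pr !left_inE; congr fine.
rewrite -[RHS](@shift3 _ _ h); last by case=> -[|[|[|?]]].
by rewrite !nth3D.
Qed.

Lemma pr_right_in_shift h p s s' q : p <= s -> s <= s' -> s' <= q ->
  pr P (right_in X (p + h) (s + h) (s' + h) (q + h)) = pr P (right_in X p s s' q).
Proof.
move=> ps ss sq; rewrite /pr !right_inE; congr fine.
rewrite -[RHS](@shift3 _ _ h); last by case=> -[|[|[|?]]].
by rewrite !nth3D.
Qed.

Lemma pr_left_in_reversed (rX : time_reversible P X) p s s' q :
  p <= s -> s <= s' -> s' <= q ->
  pr P (right_in X (- q) (- s') (- s) (- p)) = pr P (left_in X p s s' q).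
Proof.
move=> ps ss sq; rewrite -left_in_reversed /pr !left_inE; congr fine.
by apply: rX; [by case=> -[|[|[|?]]]|exact: measurable_mid_peak].
Qed.

End Stationary.

Section PathwiseUsc.
Variables (X : R -> Omega -> R) (uX : usc_paths X).

Lemma path_sup_sub w a' b' a b : a' <= a -> a <= b -> b <= b' ->
  path_sup X a b w <= path_sup X a' b' w.
Proof. exact: (@seg_sup_sub _ (X^~ w) (@uX w)). Qed.

Lemma path_sup_cat w a b c : a <= b -> b <= c ->
  path_sup X a c w = Num.max (path_sup X a b w) (path_sup X b c w).
Proof. exact: (@seg_sup_cat _ (X^~ w) (@uX w)). Qed.

Lemma left_in_window p' p s s' q q' : p' <= p -> p <= s -> s' <= q -> q <= q' ->
  left_in X p' s s' q' `<=` left_in X p s s' q.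
Proof.
move=> pp ps sq qq w [H1 H2]; split.
  by apply: le_lt_trans H1; exact: path_sup_sub.
by apply: le_trans H2; exact: path_sup_sub.
Qed.

(** The first peak dominates up to [r'] and the second one back to [s], so the two windows would
    have to beat each other, the later one strictly. *)
Lemma left_in_disjoint p s s' q p' r r' q' :
  p <= s -> s <= s' -> s' <= r -> r <= r' -> r' <= q -> p' <= s -> r' <= q' ->
  [disjoint left_in X p s s' q & left_in X p' r r' q'].
Proof.
move=> ps ss sr rr rq ps' rq'; apply/disj_setPS => w [[_ H1] [H2 _]] /=.
have : path_sup X r r' w <= path_sup X s' q w by exact: path_sup_sub.
have : path_sup X s s' w <= path_sup X p' r w by exact: path_sup_sub.
lra.
Qed.

Lemma left_in_split p s s' r q : p <= s -> s <= s' -> s' <= r -> r <= q ->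
  left_in X p s r q = left_in X p s s' q `|` left_in X p s' r q.
Proof.
move=> ps ss sr rq; have E w :
  [/\ path_sup X s r w = Num.max (path_sup X s s' w) (path_sup X s' r w),
    path_sup X p s' w = Num.max (path_sup X p s w) (path_sup X s s' w) &
    path_sup X s' q w = Num.max (path_sup X s' r w) (path_sup X r q w)].
  by split; exact: path_sup_cat.
apply/seteqP; split=> w; have [E1 E2 E3] := E w; rewrite /left_in /= E1 E2 E3;
  rewrite !lt_max !le_max !gt_max !ge_max.
- case=> H1 H2; have [cb|bc] := leP (path_sup X s' r w) (path_sup X s s' w).
    by left; split; lra.
  by right; split; lra.
- by case=> -[H1 H2]; split; lra.
Qed.

End PathwiseUsc.
End LeftmostPeak.

(** * One-sided limits under monotonicity *)

Section RightLimit.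
Context {R : realType}.

Lemma natmul_bounded_le0 (x C : R) : (forall n, n%:R * x <= C) -> x <= 0.
Proof.
move=> H; rewrite leNgt; apply/negP => x0.
have := H (Num.truncn (C / x)).+1; apply/negP; rewrite -ltNge.
by rewrite -ltr_pdivrMr//; exact: truncnS_gt.
Qed.

Lemma le_small_slack (x y C e : R) : 0 < e ->
  (forall k, 0 < k < e -> x <= y + C * k) -> x <= y.
Proof.
move=> e0 H; apply/ler_addgt0Pr => z z0.
have C1 : 0 < `|C| + 1 by rewrite ltr_pwDr.
pose k := Num.min (e / 2) (z / (`|C| + 1)).
have k0 : 0 < k by rewrite lt_min !divr_gt0.
have ke : k < e by rewrite /k gt_min; apply/orP; left; lra.
apply: (le_trans (H k _)); first by rewrite k0.
rewrite lerD2l; apply: (@le_trans _ _ ((`|C| + 1) * k)).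
  by apply: ler_wpM2r; [exact: ltW|have := ler_norm C; lra].
by rewrite mulrC -ler_pdivlMr// ge_min lexx orbT.
Qed.

(* Two-parameter version of the existence of one-sided limits of monotone
   functions; the supermodularity hypothesis makes the increments in the first
   variable small uniformly in the second. *)
Lemma joint_monotone_limit (D : R -> R -> R) (q : R -> R) (dl C : R) : 0 < dl ->
  (forall x x' y, 0 < x -> x <= x' -> x' < dl -> 0 < y -> y < dl ->
     D x' y <= D x y) ->
  (forall x y y', 0 < x -> x < dl -> 0 < y -> y <= y' -> y' < dl ->
     D x y <= D x y') ->
  (forall x x' y y', 0 < x -> x <= x' -> x' < dl ->
     0 < y -> y <= y' -> y' < dl -> D x y - D x' y <= D x y' - D x' y') ->
  (forall x y, 0 < x -> x < dl -> 0 < y -> y < dl -> 0 <= D x y <= C) ->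
  (forall k h, 0 < k -> k < h -> 2 * h < dl -> h * q h <= h * D k (2 * h) + C * k) ->
  (forall k h, 0 < k -> k < h -> 2 * h < dl -> (h - k) * D h k <= h * q h) ->
  cvg (q h @[h --> 0^'+]).
Proof.
move=> dl0 Dx Dy super DC qle qge.
pose Dset y := [set D x y | x in [set x | 0 < x < dl]].
pose u y := sup (Dset y).
have supD y : 0 < y < dl -> has_sup (Dset y).
  move=> ydl; split.
    by exists (D (dl / 2) y); exists (dl / 2) => //=; lra.
  exists C => _ [x /= xdl <-].
  by have /andP[] : 0 <= D x y <= C by apply: DC; lra.
have uge x y : 0 < x < dl -> 0 < y < dl -> D x y <= u y.
  move=> xdl ydl; apply: sup_upper_bound; first exact: supD.
  by exists x.
have u0 y : 0 < y < dl -> 0 <= u y.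
  move=> ydl; have /andP[D0 _] : 0 <= D (dl / 2) y <= C by apply: DC; lra.
  by apply: le_trans D0 _; apply: uge; lra.
(* [U] is the iterated limit of [D], first in [x] and then in [y]; monotonicity turns the two limits
   into a supremum and an infimum. *)
pose U := inf [set u y | y in [set y | 0 < y < dl]].
have infu : has_inf [set u y | y in [set y | 0 < y < dl]].
  split; first by exists (u (dl / 2)); exists (dl / 2) => //=; lra.
  by exists 0 => _ [y /= ydl <-]; exact: u0.
have Ule y : 0 < y < dl -> U <= u y.
  by move=> ydl; apply: inf_lbound; [exact: (proj2 infu)|exists y].
have U0 : 0 <= U.
  by apply: lb_le_inf; [exact: (proj1 infu)|move=> _ [y /= ydl <-]; exact: u0].
have umono y y' : 0 < y -> y <= y' -> y' < dl -> u y <= u y'.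
  move=> y0 yy ydl; apply: ge_sup; first by apply: (proj1 (supD _ _)); lra.
  move=> _ [x /= xdl <-]; apply: (@le_trans _ _ (D x y')); first by apply: Dy; lra.
  by apply: uge; lra.
have d2 : dl / 2 < dl by lra.
have d20 : 0 < dl / 2 by lra.
apply/cvg_ex; exists U => /=; apply/cvgrPdist_le => e e0.
have [y1 /andP[y10 y1dl] uy1] : exists2 y, 0 < y < dl & u y < U + e.
  have [_ [y /= ydl <-] uy] := inf_adherent e0 infu; by exists y.
have [x1 /andP[x10 x1dl] ux1] : exists2 x, 0 < x < dl & u (dl / 2) - e < D x (dl / 2).
  have hs : has_sup (Dset (dl / 2)) by apply: supD; rewrite d20.
  have [_ [x /= xdl <-] ux] := sup_adherent e0 hs; by exists x.
near=> h.
have h0 : 0 < h by near: h; exact: nbhs_right_gt.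
have hd2 : h < dl / 2 by near: h; exact: nbhs_right_lt.
have hy1 : h < y1 / 2 by near: h; apply: nbhs_right_lt; rewrite divr_gt0.
have hx1 : h < x1 by near: h; exact: nbhs_right_lt.
have hdl : h < dl := lt_trans hd2 d2.
have h20 : 0 < 2 * h by rewrite mulr_gt0.
have h2dl : 2 * h < dl by rewrite mulrC -ltr_pdivlMr.
have h2y1 : 2 * h < y1 by rewrite mulrC -ltr_pdivlMr.
rewrite ler_distlC; apply/andP; split.
- rewrite -(ler_pM2l h0); apply: (@le_small_slack _ _ U h) => // k /andP[k0 kh].
  have kd2 : k < dl / 2 := lt_trans kh hd2.
  have kdl : k < dl := lt_trans kd2 d2.
  have k0dl : 0 < k < dl by rewrite k0.
  have Dhk : U - e <= D h k.
    rewrite lerBlDr; apply: (le_trans (Ule k k0dl)).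
    apply: ge_sup; first exact: (proj1 (supD _ k0dl)).
    move=> _ [x /= /andP[x0 xdl] <-]; have [xh|hx] := leP x h; last first.
      by apply: (le_trans (Dx h x k h0 (ltW hx) xdl k0 kdl)); rewrite lerDl ltW.
    have s1 := super x h k (dl / 2) x0 xh hdl k0 (ltW kd2) d2.
    have s2 : D x (dl / 2) <= u (dl / 2) by apply: uge; rewrite ?x0 ?d20.
    have s3 := Dx h x1 (dl / 2) h0 (ltW hx1) x1dl d20 d2.
    by move: s1 s2 s3 ux1; clear; lra.
  have s1 := qge k h k0 kh h2dl.
  have s2 : (h - k) * (U - e) <= (h - k) * D h k by rewrite ler_wpM2l// subr_ge0 ltW.
  have s3 : 0 <= k * e by rewrite mulr_ge0// ltW.
  by move: s1 s2 s3; clear; rewrite [(h - k) * (U - e)]mulrBl mulrBr; lra.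
- rewrite -(ler_pM2l h0); apply: (@le_small_slack _ _ C h) => // k /andP[k0 kh].
  have Dk : D k (2 * h) <= U + e.
    apply: (@le_trans _ _ (u (2 * h))).
      by apply: uge; rewrite ?k0 ?h20 ?(lt_trans kh).
    exact: le_trans (umono _ _ h20 (ltW h2y1) y1dl) (ltW uy1).
  apply: (le_trans (qle k h k0 kh h2dl)); rewrite lerD2r.
  by rewrite ler_wpM2l// ltW.
Unshelve. all: by end_near.
Qed.

End RightLimit.

(** * Peak probabilities as functions of three lengths *)

Section PeakLaw.
Context (d : measure_display) (Omega : measurableType d) (R : realType).
Variables (P : probability Omega R) (X : R -> Omega -> R).
Hypotheses (stX : stationary P X) (uX : usc_paths X).
Implicit Types (a b e h t T : R).

(** [b] is measured from the left end of the window, so the length dominated after the window is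
    [b - e]. *)
Definition peak_prob a e b : R := pr P (left_in X (- a) 0 e b).

Lemma peak_probE p s s' q : p <= s -> s <= s' -> s' <= q ->
  pr P (left_in X p s s' q) = peak_prob (s - p) (s' - s) (q - s).
Proof.
move=> ps ss sq; rewrite -(pr_left_in_shift stX (- s))//.
by rewrite subrr /peak_prob opprB.
Qed.

Lemma peak_prob_ge0 a e b : 0 <= peak_prob a e b.
Proof. exact: pr_ge0. Qed.

Lemma peak_prob_mono a a' e b b' : 0 <= a -> a <= a' -> 0 <= e -> e <= b ->
  b <= b' -> peak_prob a' e b' <= peak_prob a e b.
Proof.
move=> a0 aa e0 eb bb.
apply: pr_le; try by apply: (measurable_left_in stX); lra.
by apply: (left_in_window uX); lra.
Qed.

(** Additivity is exact because the leftmost location lies in exactly one of the two half-open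
    pieces. *)
Lemma peak_prob_split a e h b : 0 <= a -> 0 <= e -> 0 <= h -> e + h <= b ->
  peak_prob a (e + h) b = peak_prob a e b + peak_prob (a + e) h (b - e).
Proof.
move=> a0 e0 h0 ehb; rewrite /peak_prob (@left_in_split _ _ _ _ uX _ _ e); try lra.
rewrite prU; try by apply: (measurable_left_in stX); lra.
  by rewrite [X in _ + X = _]peak_probE; try lra; congr (_ + peak_prob _ _ _); ring.
by apply: (left_in_disjoint uX); lra.
Qed.

Lemma peak_prob_mono_width a e e' b : 0 <= a -> 0 <= e -> e <= e' -> e' <= b ->
  peak_prob a e b <= peak_prob a e' b.
Proof.
move=> a0 e0 ee eb; have -> : e' = e + (e' - e) by ring.
rewrite peak_prob_split; try lra.
by rewrite lerDl peak_prob_ge0.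
Qed.

Lemma peak_prob_sum n a e b : 0 <= a -> 0 <= e -> n%:R * e <= b ->
  peak_prob a (n%:R * e) b =
  \sum_(k < n) peak_prob (a + k%:R * e) e (b - k%:R * e).
Proof.
move=> a0 e0; elim: n => [|n IH] nb.
  rewrite big_ord0 mul0r; apply/eqP; rewrite eq_le peak_prob_ge0 andbT.
  rewrite /peak_prob (_ : left_in _ _ _ _ _ = set0) ?/pr ?measure0//.
  apply/seteqP; split=> // w [+ _] /=.
  have : path_sup X 0 0 w <= path_sup X (- a) 0 w by apply: (path_sup_sub uX); lra.
  lra.
have ne : 0 <= n%:R * e by rewrite mulr_ge0.
move: nb; rewrite -natr1 mulrDl mul1r => nb.
rewrite peak_prob_split//; rewrite big_ord_recr/= IH//; lra.
Qed.

(** The pieces have outer lengths [a + k e] and [b - k e]; enlarging them to common values can only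
    lower each probability. *)
Lemma peak_prob_ge_avg n a e b : 0 <= a -> 0 <= e -> n%:R * e <= b ->
  n%:R * peak_prob (a + n%:R * e) e (b + e) <= peak_prob a (n%:R * e) b.
Proof.
move=> a0 e0 nb; rewrite peak_prob_sum//.
rewrite mulr_natl -[X in _ *+ X]card_ord -sumr_const.
apply: ler_sum => k _.
have ke0 : 0 <= k%:R * e by rewrite mulr_ge0.
have ke : k%:R * e <= n%:R * e by rewrite ler_wpM2r// ler_nat ltnW.
have k1e : k%:R * e + e <= n%:R * e.
  by rewrite -{2}[e]mul1r -mulrDl ler_wpM2r// natr1 ler_nat.
by apply: peak_prob_mono; lra.
Qed.

Lemma peak_prob_le_avg n a e b b' : 0 <= a -> 0 <= e -> 0 <= b' ->
  b' + n%:R * e <= b -> peak_prob a (n%:R * e) b <= n%:R * peak_prob a e (b' + e).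
Proof.
move=> a0 e0 b'0 nb; rewrite peak_prob_sum; [|lra..].
rewrite mulr_natl -[X in _ *+ X]card_ord -sumr_const.
apply: ler_sum => k _.
have ke0 : 0 <= k%:R * e by rewrite mulr_ge0.
have k1e : k%:R * e + e <= n%:R * e.
  by rewrite -{2}[e]mul1r -mulrDl ler_wpM2r// natr1 ler_nat.
by apply: peak_prob_mono; lra.
Qed.

(** Each difference is the probability that the peak survives on the left up to [a] but not up to
    [a'], and survives on the right. Only the last requirement involves [b], and it becomes harder
    as [b] grows. *)
Lemma peak_prob_supermodular a a' e b b' : 0 <= a -> a <= a' -> 0 <= e ->
  e <= b -> b <= b' ->
  peak_prob a e b' - peak_prob a' e b' <= peak_prob a e b - peak_prob a' e b.
Proof.
move=> a0 aa e0 eb bb; rewrite /peak_prob.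
have m x y : 0 <= x -> e <= y -> measurable (left_in X (- x) 0 e y).
  by move=> ? ?; apply: (measurable_left_in stX); lra.
rewrite -!prD; try by apply: m; lra.
- apply: pr_le; try by apply: measurableD; apply: m; lra.
  move=> w [Hw nHw]; split; first by apply: (left_in_window uX _ _ _ _ Hw); lra.
  by move=> [H1 H2]; apply: nHw; split=> //; exact: (proj2 Hw).
- by apply: (left_in_window uX); lra.
- by apply: (left_in_window uX); lra.
Qed.

(** Peaks of this kind repel each other at distances up to min(a, b). Counting them among [n]
    consecutive windows leaves an error independent of [n], which disappears as [n] grows. *)
Lemma peak_prob_bound a e b : 0 < a -> 0 < b -> 0 <= e ->
  peak_prob a e (b + e) * Num.min a b <= e.
Proof.
move=> a0 b0 e0.
have [] : [/\ 0 < Num.min a b, Num.min a b <= a & Num.min a b <= b].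
  by rewrite lt_min a0 !ge_min !lexx orbT.
move: (Num.min a b) => m m0 ma mb.
rewrite -subr_le0; apply: (@natmul_bounded_le0 _ _ (2 * m)) => n.
pose A k := left_in X (k%:R * e - a) (k%:R * e) (k%:R * e + e) (k%:R * e + e + b).
have mA k : measurable (A k) by apply: (measurable_left_in stX); lra.
have prA k : pr P (A k) = peak_prob a e (b + e).
  by rewrite peak_probE; [congr peak_prob; ring|lra..].
have := @sum_pr_le _ _ _ P n A (fun=> set0) ((n%:R * e + 2 * m) / m) mA (fun=> measurable0).
have count w : \sum_(k < n) (\1_(A k) w + \1_set0 w) <= (n%:R * e + 2 * m) / m.
  (* The second kind of marks is empty, and [c = 2 * m] makes [m] the required gap between marks of
     the first kind. *)
  have : 2 * m / 2 * (\sum_(k < n) ((w \in A k)%:R + false%:R)) <=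
      n%:R * e + 2 * m.
    apply: (@count_marks _ (fun k => w \in A k) (fun=> false)) => //; first lra.
    move=> j k jk jA kA; rewrite leNgt; apply/negP => close.
    have jk' : j%:R * e + e <= k%:R * e.
      by rewrite -{2}[e]mul1r -mulrDl ler_wpM2r// natr1 ler_nat.
    move: close; rewrite (natrB _ (ltnW jk)) mulrBl => close.
    have /disj_setPS/(_ w) : [disjoint A j & A k].
      by apply: (left_in_disjoint uX); lra.
    by apply; split; exact: set_mem.
  rewrite -ler_pdivlMl; last lra.
  under [in X in _ -> X]eq_bigr do rewrite !indicE in_set0.
  by rewrite (_ : (2 * m / 2)^-1 = m^-1) 1?mulrC//; congr (_^-1); field.
move=> /(_ count); under eq_bigr do rewrite prA /pr measure0 addr0.
rewrite sumr_const card_ord ler_pdivlMr// -mulr_natl; lra.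
Qed.

End PeakLaw.

(** * Dyadic peak rates and convergence of the quotient *)

Section PeakIntensity.
Context (d : measure_display) (Omega : measurableType d) (R : realType).
Variables (P : probability Omega R) (X : R -> Omega -> R).
Hypotheses (stX : stationary P X) (uX : usc_paths X).
Local Notation peak_prob := (peak_prob P X).
Implicit Types (a b e h t T : R).

Let w n : R := 2^-1 ^+ n.

Let w_gt0 n : 0 < w n. Proof. by rewrite exprn_gt0// invr_gt0. Qed.

Let wS n : w n = 2 * w n.+1. Proof. by rewrite /w exprS mulrA divff ?mul1r. Qed.

Let w_cvg : w n @[n --> \oo] --> 0.
Proof. by apply: cvg_expr; rewrite ger0_norm ?invr_ge0// invf_lt1 ?ltr1n. Qed.

(** With right length [b + w n], exactly [b] is left after the window. Under this normalisation both
    halves of a window are dominated by one and the same smaller event, so the sequence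
    increases. *)
Definition peak_rate_seq a b n : R := (w n)^-1 * peak_prob a (w n) (b + w n).

Definition peak_rate a b : R := limn (peak_rate_seq a b).

Lemma peak_rate_seq_ge0 a b n : 0 <= peak_rate_seq a b n.
Proof. by rewrite mulr_ge0 ?invr_ge0 ?peak_prob_ge0// ltW. Qed.

Lemma peak_rate_seqE a b n : w n * peak_rate_seq a b n = peak_prob a (w n) (b + w n).
Proof. by rewrite mulrA divff ?mul1r// gt_eqF. Qed.

Lemma peak_rate_seq_nd a b : 0 <= a -> 0 <= b ->
  {homo peak_rate_seq a b : m n / (m <= n)%N >-> m <= n}.
Proof.
move=> a0 b0; apply/nondecreasing_seqP => n.
rewrite -(ler_pM2l (w_gt0 n)) peak_rate_seqE wS -mulrA peak_rate_seqE.
by apply: (@peak_prob_le_avg _ _ _ _ _ stX uX 2) => //; rewrite ?ltW.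
Qed.

Lemma peak_rate_seq_le a b n : 0 < a -> 0 < b ->
  peak_rate_seq a b n <= (Num.min a b)^-1.
Proof.
move=> a0 b0; have m0 : 0 < Num.min a b by rewrite lt_min a0.
rewrite -(ler_pM2l (w_gt0 n)) peak_rate_seqE ler_pdivlMr//.
by apply: (peak_prob_bound stX uX) => //; exact: ltW.
Qed.

Lemma is_cvg_peak_rate_seq a b : 0 < a -> 0 < b -> cvgn (peak_rate_seq a b).
Proof.
move=> a0 b0; apply: nondecreasing_is_cvgn.
  by apply: peak_rate_seq_nd; exact: ltW.
by exists (Num.min a b)^-1 => _ [n _ <-]; exact: peak_rate_seq_le.
Qed.

Lemma peak_rate_seq_le_lim a b n : 0 < a -> 0 < b ->
  peak_rate_seq a b n <= peak_rate a b.
Proof.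
move=> a0 b0; apply: nondecreasing_cvgn_le; last exact: is_cvg_peak_rate_seq.
by apply: peak_rate_seq_nd; exact: ltW.
Qed.

Lemma peak_rate_ge0 a b : 0 < a -> 0 < b -> 0 <= peak_rate a b.
Proof.
move=> a0 b0; apply: le_trans (peak_rate_seq_le_lim 0 a0 b0).
exact: peak_rate_seq_ge0.
Qed.

Lemma peak_rate_le a b : 0 < a -> 0 < b -> peak_rate a b <= (Num.min a b)^-1.
Proof.
move=> a0 b0; apply: limr_le; first exact: is_cvg_peak_rate_seq.
by near=> n; exact: peak_rate_seq_le.
Unshelve. all: by end_near.
Qed.

Lemma peak_rate_mono a a' b b' : 0 < a -> a <= a' -> 0 < b -> b <= b' ->
  peak_rate a' b' <= peak_rate a b.
Proof.
move=> a0 aa b0 bb; apply: ler_lim.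
- by apply: is_cvg_peak_rate_seq; lra.
- exact: is_cvg_peak_rate_seq.
- near=> n; rewrite ler_wpM2l ?invr_ge0 ?(ltW (w_gt0 n))//.
  by have := w_gt0 n; move=> ?; apply: (peak_prob_mono stX uX); lra.
Unshelve. all: by end_near.
Qed.

Lemma peak_rate_supermodular a a' b b' : 0 < a -> a <= a' -> 0 < b -> b <= b' ->
  peak_rate a b' - peak_rate a' b' <= peak_rate a b - peak_rate a' b.
Proof.
move=> a0 aa b0 bb.
have c x y : a <= x -> b <= y -> cvgn (peak_rate_seq x y).
  by move=> ? ?; apply: is_cvg_peak_rate_seq; lra.
rewrite /peak_rate -!limB; try by apply: c.
apply: ler_lim; try by apply: is_cvgB; apply: c.
near=> n; rewrite /= -!mulrBr ler_wpM2l ?invr_ge0 ?(ltW (w_gt0 n))//.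
by have := w_gt0 n; move=> ?; apply: (peak_prob_supermodular stX uX); lra.
Unshelve. all: by end_near.
Qed.

Lemma w_near_lt e : 0 < e -> \forall n \near \oo, w n < e.
Proof. by move=> e0; have /cvgr_lt := w_cvg; exact. Qed.

(** Fill the window from inside with dyadic windows: less than [w n] of it is lost, and moving them
    to the right costs at most [e] in the left length. *)
Lemma peak_prob_ge_rate a e b : 0 <= a -> 0 < e -> e <= b ->
  e * peak_rate (a + e) b <= peak_prob a e b.
Proof.
move=> a0 e0 eb; have ae0 : 0 < a + e by lra.
have b0 : 0 < b by lra.
have : (fun n => (e - w n) * peak_rate_seq (a + e) b n) @ \oo -->
    (e - 0) * peak_rate (a + e) b.
  apply: cvgM; last exact: is_cvg_peak_rate_seq.
  by apply: cvgB => //; exact: cvg_cst.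
rewrite subr0 => /cvg_lim <-//; apply: limr_le; first by apply: is_cvgM;
  [apply: is_cvgB; [exact: is_cvg_cst|apply/cvg_ex; exists 0]|
   exact: is_cvg_peak_rate_seq].
near=> n; pose N := Num.truncn (e / w n).
have wn0 := w_gt0 n.
have /andP[Ne eN] : N%:R * w n <= e < N.+1%:R * w n.
  rewrite -ler_pdivlMr// -ltr_pdivrMr// truncn_itv//.
  by rewrite divr_ge0// ltW.
rewrite -natr1 mulrDl mul1r in eN.
apply: (@le_trans _ _ (N%:R * w n * peak_rate_seq (a + e) b n)).
  by rewrite ler_wpM2r ?peak_rate_seq_ge0//; lra.
rewrite -mulrA peak_rate_seqE.
apply: (@le_trans _ _ (peak_prob a (N%:R * w n) b)); last first.
  by apply: (peak_prob_mono_width stX uX) => //; rewrite mulr_ge0// ltW.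
apply: le_trans (peak_prob_ge_avg stX uX a0 (ltW wn0) _); last lra.
have N0 : 0 <= N%:R * w n by rewrite mulr_ge0// ltW.
by rewrite ler_wpM2l//; apply: (peak_prob_mono stX uX); lra.
Unshelve. all: by end_near.
Qed.

(** Cover the window from outside by dyadic windows. The strict inequality [b' + e < b] leaves room
    for the overshoot, which is the slack [k]. *)
Lemma peak_prob_le_rate a e b b' : 0 < a -> 0 < e -> 0 < b' -> b' + e < b ->
  peak_prob a e b <= e * peak_rate a b'.
Proof.
move=> a0 e0 b0 bb.
apply: (@le_small_slack _ _ _ (peak_rate a b') (b - b' - e)); first lra.
move=> k /andP[k0 kb].
have [n wk] : exists n, w n < k.
  by have [n _ /(_ n (leqnn n))] := w_near_lt k0; exists n.
have wn0 := w_gt0 n.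
pose N := (Num.truncn (e / w n)).+1.
have /andP[Ne eN] : N.-1%:R * w n <= e < N%:R * w n.
  rewrite -ler_pdivlMr// -ltr_pdivrMr// truncn_itv//.
  by rewrite divr_ge0// ltW.
have NE : N%:R * w n = N.-1%:R * w n + w n by rewrite -[in LHS]natr1 mulrDl mul1r.
apply: (@le_trans _ _ (peak_prob a (N%:R * w n) b)).
  by apply: (peak_prob_mono_width stX uX); lra.
apply: (@le_trans _ _ (N%:R * w n * peak_rate a b')).
  apply: (@le_trans _ _ (N%:R * w n * peak_rate_seq a b' n)); last first.
    by rewrite ler_wpM2l ?peak_rate_seq_le_lim//; lra.
  by rewrite -mulrA peak_rate_seqE; apply: (peak_prob_le_avg stX uX); lra.
rewrite [X in _ + X]mulrC -mulrDl ler_wpM2r ?peak_rate_ge0//; lra.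
Qed.

Lemma peak_prob_quotient_cvg a b : 0 < a -> 0 < b ->
  cvg (h^-1 * peak_prob a h b @[h --> 0^'+]).
Proof.
move=> a0 b0; pose dl := Num.min a b / 2.
have [dl0 da db] : [/\ 0 < dl, 2 * dl <= a & 2 * dl <= b].
  rewrite /dl mulrCA divff// mulr1 !ge_min !lexx orbT; split=> //.
  by rewrite divr_gt0// lt_min a0.
apply: (@joint_monotone_limit _ (fun x y => peak_rate (a + x) (b - y)) _ dl dl^-1 dl0).
- by move=> x x' y *; apply: peak_rate_mono; lra.
- by move=> x y y' *; apply: peak_rate_mono; lra.
- by move=> x x' y y' *; apply: peak_rate_supermodular; lra.
- move=> x y *; rewrite peak_rate_ge0//=; try lra.
  apply: (le_trans (peak_rate_le _ _)); try lra.
  have m0 : 0 < Num.min (a + x) (b - y) by rewrite lt_min; lra.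
  by rewrite lef_pV2 ?posrE// le_min; lra.
(* An initial piece of length [k] is cut off, so that the rest has left length [a + k] with [k > 0],
   as the limit criterion requires; the piece itself costs at most [k / dl]. *)
- move=> k h k0 kh hdl; rewrite mulrA divff ?mul1r; last by rewrite gt_eqF//; lra.
  have -> : peak_prob a h b = peak_prob a k b + peak_prob (a + k) (h - k) (b - k).
    rewrite -(peak_prob_split stX uX); try lra.
    by congr peak_prob; ring.
  rewrite addrC; apply: lerD.
    apply: (@le_trans _ _ ((h - k) * peak_rate (a + k) (b - 2 * h))).
      by apply: peak_prob_le_rate; lra.
    by rewrite ler_wpM2r ?peak_rate_ge0//; lra.
  rewrite ler_pdivlMl//.
  apply: (@le_trans _ _ (Num.min a (b - k) * peak_prob a k b)).
    rewrite ler_wpM2r ?peak_prob_ge0// le_min; lra.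
  rewrite mulrC; have := @peak_prob_bound _ _ _ _ _ stX uX a k (b - k).
  by rewrite subrK; apply; lra.
- move=> k h k0 kh hdl; rewrite mulrA divff ?mul1r; last by rewrite gt_eqF//; lra.
  have -> : peak_prob a h b = peak_prob a k b + peak_prob (a + k) (h - k) (b - k).
    rewrite -(peak_prob_split stX uX); try lra.
    by congr peak_prob; ring.
  rewrite -[leLHS]add0r lerD ?peak_prob_ge0//.
  have -> : a + h = a + k + (h - k) by ring.
  by apply: peak_prob_ge_rate; lra.
Qed.

End PeakIntensity.

(** * From peak probabilities to the density *)

Section SupDensity.
Context (d : measure_display) (Omega : measurableType d) (R : realType).
Variables (P : probability Omega R) (X : R -> Omega -> R).
Hypotheses (stX : stationary P X) (uX : usc_paths X).
Local Notation peak_prob := (peak_prob P X).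
Implicit Types (a b e h t T : R).

Lemma sup_location_le T t w : 0 < t < T ->
  (sup_location X T w <= t) = (path_sup X t T w <= path_sup X 0 t w).
Proof.
move=> /andP[t0 tT]; have uw : usc (X^~ w) by exact: uX.
have T0 : 0 < T by lra.
have lbL : has_lbound (sup_locations X T w).
  by exists 0 => s /= [/andP[]].
have supE : path_sup X 0 T w = Num.max (path_sup X 0 t w) (path_sup X t T w).
  by apply: (path_sup_cat uX); lra.
apply/idP/idP => [loc|le].
- rewrite leNgt; apply/negP => lt; move: loc; apply/negP; rewrite -ltNge.
  have E : path_sup X 0 T w = path_sup X t T w.
    by rewrite supE; apply/max_idPr/ltW.
  have [s /= /andP[s0 sT] sE] := seg_sup_attained uw (ltW T0).
  have Xt : X t w < path_sup X 0 T w.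
    rewrite E; apply: le_lt_trans lt.
    by apply: (@seg_sup_ub _ _ uw); lra.
  (* That every location exceeds [t] would only give [t] as a lower bound of the infimum;
     semi-continuity at [t] supplies a whole gap after [t] without locations. *)
  have [/= e e0 He] := usc_near uw Xt.
  apply: (@lt_le_trans _ _ (t + e)); first by rewrite ltrDl.
  apply: lb_le_inf; first by exists s; split; [rewrite s0|].
  move=> r /= [/andP[r0 rT] rE]; rewrite leNgt; apply/negP => rte.
  have [rt|tr] := leP r t.
    have : X r w <= path_sup X 0 t w by apply: (@seg_sup_ub _ _ uw); rewrite r0.
    by rewrite rE E; lra.
  have : X r w < path_sup X 0 T w.
    by apply: He; rewrite /= ltr_distlC; lra.
  by rewrite rE ltxx.
- have E : path_sup X 0 T w = path_sup X 0 t w by rewrite supE; apply/max_idPl.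
  have [s /andP[s0 st] sE] := seg_sup_attained uw (ltW t0).
  apply: (@le_trans _ _ s) => //; apply: (ge_inf lbL); split; first by lra.
  by rewrite E.
Qed.

Lemma sup_location_cdfE T t : 0 < t < T -> sup_location_cdf P X T t =
  pr P [set w | path_sup X t T w <= path_sup X 0 t w].
Proof.
move=> tT; rewrite /sup_location_cdf /pushforward /pr; congr (fine (P _)).
apply/seteqP; split=> w /=; rewrite in_itv/= sup_location_le//.
Qed.

Lemma sup_location_cdfB T t h : 0 < t -> 0 <= h -> t + h < T ->
  sup_location_cdf P X T (t + h) - sup_location_cdf P X T t =
  peak_prob t h (T - t).
Proof.
move=> t0 h0 thT; rewrite !sup_location_cdfE; try lra.
have m u : 0 < u < T -> measurable [set w | path_sup X u T w <= path_sup X 0 u w].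
  move=> uT.
  by apply: measurable_le_set; apply: (measurable_path_sup stX); lra.
have E w : [/\ path_sup X 0 (t + h) w = Num.max (path_sup X 0 t w) (path_sup X t (t + h) w) &
    path_sup X t T w = Num.max (path_sup X t (t + h) w) (path_sup X (t + h) T w)].
  by split; apply: (path_sup_cat uX); lra.
rewrite -prD; try by apply: m; lra.
  have -> : peak_prob t h (T - t) = pr P (left_in X 0 t (t + h) T).
    rewrite (peak_probE stX); try lra.
    by rewrite subr0 addrAC subrr add0r.
  congr (pr P _); apply/seteqP; split=> w; rewrite /left_in /=;
    have [-> ->] := E w; rewrite le_max ge_max => -[].
    move=> H1 /negP; rewrite negb_and -!ltNge => H2; split; lra.
  by move=> H1 H2; split; [lra|move=> ?; lra].
by move=> w /=; have [-> ->] := E w; rewrite le_max ge_max; lra.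
Qed.

Lemma cdf_quotientE T t h : 0 < t -> 0 <= h -> t + h < T ->
  cdf_quotient P X T t h = h^-1 * peak_prob t h (T - t).
Proof. by move=> *; rewrite /cdf_quotient sup_location_cdfB. Qed.

Lemma stationary_has_sup_density T : has_sup_density P X T.
Proof.
move=> t /andP[t0 tT].
have Tt : 0 < T - t by rewrite subr_gt0.
have /cvg_ex[l ql] := peak_prob_quotient_cvg stX uX t0 Tt.
apply/cvg_ex; exists l; apply: cvg_trans ql; apply: near_eq_cvg; near=> h.
have h0 : 0 < h by near: h; exact: nbhs_right_gt.
have hT : h < T - t by near: h; exact: nbhs_right_lt.
by rewrite cdf_quotientE; lra.
Unshelve. all: by end_near.
Qed.

(** Cutting the window into [n.+1] equal pieces can only raise this quotient, so one window of any
    fixed length bounds the density from below. Here the right length includes the window. *)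
Lemma sup_density_ge T t e : 0 < t < T -> 0 < e ->
  e^-1 * peak_prob t e (T - t + e) <= sup_density P X T t.
Proof.
move=> /andP[t0 tT] e0.
have dens : cvg (cdf_quotient P X T t h @[h --> 0^'+]).
  by apply: stationary_has_sup_density; rewrite t0.
rewrite leNgt; apply/negP => lt.
have /cvgr_lt/(_ _ lt) [r /= r0 Hr] := dens.
have [n nr] : exists n : nat, e / n.+1%:R < Num.min r (T - t).
  have m0 : 0 < Num.min r (T - t) by rewrite lt_min r0; lra.
  exists (Num.truncn (e / Num.min r (T - t))).
  by rewrite ltr_pdivrMr// mulrC -ltr_pdivrMr//; exact: truncnS_gt.
set h := e / n.+1%:R in nr.
have h0 : 0 < h by rewrite divr_gt0.
have nh : n.+1%:R * h = e by rewrite mulrC divfK.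
move: nr; rewrite lt_min => /andP[hr hT].
have := Hr h; rewrite /= sub0r normrN gtr0_norm// => /(_ hr h0).
apply/negP; rewrite -leNgt cdf_quotientE; try lra.
have avg : peak_prob t e (T - t + e) <= n.+1%:R * peak_prob t h (T - t).
  rewrite -nh -[in leRHS](subrK h (T - t)).
  by apply: (peak_prob_le_avg stX uX); lra.
rewrite ler_pdivrMl// mulrA.
by have -> : e * h^-1 = n.+1%:R by rewrite -nh mulfK ?gt_eqF.
Qed.

End SupDensity.

(** * The upper bound under reversibility *)

Section ReversibleBound.
Context (d : measure_display) (Omega : measurableType d) (R : realType).
Variables (P : probability Omega R) (X : R -> Omega -> R).
Hypotheses (stX : stationary P X) (uX : usc_paths X).
Local Notation peak_prob := (peak_prob P X).

Section Reversal.
Variable T : R.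
Hypotheses (rX : time_reversible P X) (unX : unique_sup_location P X T).

(** The rightmost location may be [s] itself, which a leftmost window starting at [s] would miss;
    starting at [r < s] includes it. A tie with [[0, r]] would be a second location. *)
Lemma right_in_sub_left_in s s' r w : 0 <= r -> r < s -> s <= s' -> s' <= T ->
  (exists! t, sup_locations X T w t) ->
  right_in X 0 s s' T w -> left_in X 0 r s' T w.
Proof.
move=> r0 rs ss sT [z [_ zU]] [H1 H2]; have uw : usc (X^~ w) by exact: uX.
have Mle : path_sup X s s' w <= path_sup X r s' w by apply: (path_sup_sub uX); lra.
split; last lra.
rewrite ltNge; apply/negP => H3.
have H4 : path_sup X 0 r w <= path_sup X 0 s w by apply: (path_sup_sub uX); lra.
have E : path_sup X 0 T w = path_sup X s s' w.
  rewrite (path_sup_cat uX _ (b := s')); try lra.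
  rewrite (path_sup_cat uX _ (b := s)); try lra.
  by apply/eqP; rewrite eq_le ge_max le_max ge_max le_max; lra.
have [x xr Ex] := seg_sup_attained uw r0.
have [y ys Ey] := seg_sup_attained uw ss.
have {}Ex : X x w = path_sup X 0 r w := Ex.
have {}Ey : X y w = path_sup X s s' w := Ey.
have Lx : sup_locations X T w x.
  by split; [lra|apply/eqP; rewrite E eq_le Ex; lra].
have Ly : sup_locations X T w y by split; [lra|rewrite E].
have := zU _ Lx; have := zU _ Ly; lra.
Qed.

Lemma peak_prob_reversal_slack t h k : 0 < t -> 0 <= h -> 0 < k -> k < T - t - h ->
  peak_prob t h (T - t) <= peak_prob (T - t - h - k) (h + k) (t + h + k).
Proof.
move=> t0 h0 k0 kT.
have -> : peak_prob t h (T - t) = pr P (left_in X 0 t (t + h) T).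
  rewrite (peak_probE stX); try lra.
  by rewrite subr0 addrAC subrr add0r.
rewrite -(pr_left_in_reversed rX); try lra.
rewrite -(pr_right_in_shift stX T); try lra.
have -> : peak_prob (T - t - h - k) (h + k) (t + h + k) =
    pr P (left_in X 0 (T - t - h - k) (T - t) T).
  rewrite (peak_probE stX); try lra.
  by congr peak_prob; ring.
have [N [mN N0 subN]] := unX.
have mL : measurable (left_in X 0 (T - t - h - k) (T - t) T).
  by apply: (measurable_left_in stX); lra.
have -> : pr P (left_in X 0 (T - t - h - k) (T - t) T) =
    pr P (left_in X 0 (T - t - h - k) (T - t) T) + pr P N.
  by rewrite /pr N0 addr0.
apply: le_trans (prU_le P mL mN).
rewrite addNr oppr0 add0r !(addrC _ T).
apply: pr_le; [by apply: (measurable_right_in stX); lra|exact: measurableU|].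
move=> w Hw; have [un|nun] := pselect (exists! t, sup_locations X T w t).
  by left; apply: (right_in_sub_left_in _ _ _ _ un Hw); lra.
by right; apply: subN.
Qed.

(** The extra strip of width [k] needed by the reversal has probability of order [k] by
    [peak_prob_bound], so it can be removed. *)
Lemma peak_prob_reversal t h : 0 < t -> 0 <= h -> h < T - t ->
  peak_prob t h (T - t) <= peak_prob (T - t - h) h (t + h).
Proof.
move=> t0 h0 hT; pose s := T - t - h.
have m0 : 0 < Num.min (s / 2) (t + h) by rewrite lt_min /s; lra.
apply: (@le_small_slack _ _ _ (Num.min (s / 2) (t + h))^-1 (s / 2)).
  by rewrite /s; lra.
move=> k /andP[k0 ks].
have kT : k < T - t - h by rewrite -/s; lra.
apply: (le_trans (peak_prob_reversal_slack t0 h0 k0 kT)).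
rewrite [h + k]addrC (peak_prob_split stX uX); try lra.
rewrite subrK addrK addrC lerD2l mulrC ler_pdivlMr//.
apply: (@le_trans _ _ (peak_prob (s / 2) k (t + h + k) * Num.min (s / 2) (t + h))).
  rewrite ler_pM2r//; apply: (peak_prob_mono stX uX); rewrite -/s; lra.
by apply: (peak_prob_bound stX uX); lra.
Qed.

(** The marks [A] dominate lengths (t, T - t - h) and the marks [B] lengths (T - t - h, t). An [A]
    before a [B] excludes it at distances up to T - t - h, a [B] before an [A] up to t, and equal
    kinds up to the minimum of both. The last hypothesis says which mixed order provides the gap
    [c]. Reversal makes [A] at most as likely as [B], which gives the bound for [A] alone. *)
Lemma peak_prob_reversible_bound t h c : 0 < t -> 0 < h -> 0 <= c ->
  h < T - t -> c / 2 <= t -> c / 2 <= T - t - h -> c <= T - t - h \/ c <= t ->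
  c * peak_prob t h (T - t) <= h.
Proof.
move=> t0 h0 c0 hT ct cT cc.
pose A k := left_in X (k%:R * h - t) (k%:R * h) (k%:R * h + h) (k%:R * h + (T - t)).
pose B k := left_in X (k%:R * h - (T - t - h)) (k%:R * h) (k%:R * h + h)
  (k%:R * h + (t + h)).
have mA k : measurable (A k) by apply: (measurable_left_in stX); lra.
have mB k : measurable (B k) by apply: (measurable_left_in stX); lra.
have prA k : pr P (A k) = peak_prob t h (T - t).
  by rewrite (peak_probE stX); [congr peak_prob; ring|lra..].
have prB k : pr P (B k) = peak_prob (T - t - h) h (t + h).
  by rewrite (peak_probE stX); [congr peak_prob; ring|lra..].
have gap (j k : nat) : (j < k)%N -> (k - j)%:R * h = k%:R * h - j%:R * h /\
    j%:R * h + h <= k%:R * h.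
  move=> jk; rewrite (natrB _ (ltnW jk)) mulrBl; split=> //.
  by rewrite -{2}[h]mul1r -mulrDl ler_wpM2r ?(ltW h0)// natr1 ler_nat.
have excl (E F : nat -> set Omega) (m : R) :
    (forall (j k : nat), (j < k)%N -> k%:R * h - j%:R * h <= m ->
       [disjoint E j & F k]) ->
    forall w (j k : nat), (j < k)%N -> w \in E j -> w \in F k -> m <= (k - j)%:R * h.
  move=> EF w j k jk /set_mem Ej /set_mem Fk; rewrite leNgt; apply/negP => close.
  have [G1 G2] := gap j k jk.
  have /disj_setPS/(_ w) : [disjoint E j & F k] by apply: EF => //; lra.
  by apply; split.
have AA : forall w (j k : nat), (j < k)%N -> w \in A j -> w \in A k -> c / 2 <= (k - j)%:R * h.
  apply: excl => j k jk close; have [G1 G2] := gap j k jk.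
  by apply: (left_in_disjoint uX); lra.
have BB : forall w (j k : nat), (j < k)%N -> w \in B j -> w \in B k -> c / 2 <= (k - j)%:R * h.
  apply: excl => j k jk close; have [G1 G2] := gap j k jk.
  by apply: (left_in_disjoint uX); lra.
have count w n : c / 2 * \sum_(k < n) (\1_(A k) w + \1_(B k) w) <= n%:R * h + c.
  under eq_bigr do rewrite !indicE.
  case: cc => cc.
    apply: (@count_marks _ (fun k => w \in A k) (fun k => w \in B k));
      [exact: ltW|by []|exact: AA|exact: BB|].
    apply: excl => j k jk close; have [G1 G2] := gap j k jk.
    by apply: (left_in_disjoint uX); lra.
  under eq_bigr do rewrite addrC.
  apply: (@count_marks _ (fun k => w \in B k) (fun k => w \in A k));
    [exact: ltW|by []|exact: BB|exact: AA|].
  apply: excl => j k jk close; have [G1 G2] := gap j k jk.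
  by apply: (left_in_disjoint uX); lra.
have [->|c_neq0] := eqVneq c 0; first by rewrite mul0r ltW.
have cgt0 : 0 < c by rewrite lt_neqAle eq_sym c_neq0.
rewrite -subr_le0; apply: (@natmul_bounded_le0 _ _ c) => n.
have := @sum_pr_le _ _ _ P n A B ((c / 2)^-1 * (n%:R * h + c)) mA mB.
have {}count w : \sum_(k < n) (\1_(A k) w + \1_(B k) w) <= (c / 2)^-1 * (n%:R * h + c).
  by rewrite ler_pdivlMl ?divr_gt0//; exact: count.
move=> /(_ count); under eq_bigr do rewrite prA prB.
rewrite sumr_const card_ord -[_ *+ n]mulr_natl ler_pdivlMl ?divr_gt0//.
have : n%:R * (c * peak_prob t h (T - t)) <=
    n%:R * (c * peak_prob (T - t - h) h (t + h)).
  by rewrite ler_wpM2l// ler_wpM2l// peak_prob_reversal// ltW.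
by rewrite mulrBr; lra.
Qed.

Lemma sup_density_reversible_le t c : 0 < t < T -> 0 < c ->
  c / 2 <= t -> c / 2 <= T - t -> c <= T - t \/ c <= t ->
  sup_density P X T t <= c^-1.
Proof.
move=> /andP[t0 tT] c0 ct cT cc.
have dens : cvg (cdf_quotient P X T t h @[h --> 0^'+]).
  by apply: stationary_has_sup_density; rewrite ?t0.
rewrite -[leRHS]mul1r ler_pdivlMr// mulrC.
(* The window itself consumes [h] of the right length; lowering [c] by [2 * h] restores both
   [c / 2 <= T - t - h] and the mixed-gap condition. *)
have lim1 : (c - 2 * h) * cdf_quotient P X T t h @[h --> 0^'+] -->
    (c - 2 * 0) * sup_density P X T t.
  apply: cvgM => //; apply: cvgB; first exact: cvg_cst.
  by apply: cvgM; [exact: cvg_cst|exact: cvg_at_right_filter].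
rewrite mulr0 subr0 in lim1; rewrite -(cvg_lim _ lim1)//.
apply: limr_le; first by apply/cvg_ex; eexists; exact: lim1.
near=> h.
have h0 : 0 < h by near: h; exact: nbhs_right_gt.
have hT : h < T - t by near: h; apply: nbhs_right_lt; lra.
have hc : h < c / 2 by near: h; apply: nbhs_right_lt; lra.
have thT : t + h < T by rewrite addrC -ltrBrDr.
rewrite (cdf_quotientE stX uX t0 (ltW h0) thT).
rewrite mulrCA ler_pdivrMl// mulr1.
by apply: peak_prob_reversible_bound => //; lra.
Unshelve. all: by end_near.
Qed.

Lemma sup_density_reversible_bound t : 0 < t < T ->
  sup_density P X T t <= density_bound T t.
Proof.
move=> t0T; rewrite /density_bound.
case: ifPn => [t1|]; first by apply: sup_density_reversible_le => //; lra.
rewrite -ltNge => t1; case: ifPn => [t2|].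
  by apply: sup_density_reversible_le => //; lra.
rewrite -ltNge => t2; case: ifPn => [t3|].
  by apply: sup_density_reversible_le => //; lra.
by rewrite -ltNge => t3; apply: sup_density_reversible_le => //; lra.
Qed.

End Reversal.
End ReversibleBound.

(** * Affine changes of variables and normal integrals *)

Section AffineChange.
Context {R : realType}.
Local Notation mu := (@lebesgue_measure R).

Let affine (r c : R) (y : measurableTypeR R) : measurableTypeR R := r * y + c.

Let maffine r c : measurable_fun setT (affine r c).
Proof. by apply: measurable_funD => //; exact: measurable_funM. Qed.

(** By uniqueness of Lebesgue measure it suffices to compare half-open intervals with the rescaled
    image measure. *)
Lemma lebesgue_measure_affine (r : {posnum R}) (c : R) (A : set R) :
  measurable A -> mu A = (r%:num%:E * mu ((fun y => r%:num * y + c)%R @^-1` A))%E.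
Proof.
move=> mA; have [nu nuE] : exists nu : {measure set (measurableTypeR R) -> \bar R},
    forall B, nu B = pushforward mu (affine r%:num c) B.
  by exists (measure_function_pushforward__canonical__measure_function_Measure
    mu (maffine r%:num c)).
rewrite (@lebesgue_measure_unique _ (mscale r%:num%:nng nu))//=.
  by rewrite /mscale nuE.
move=> _ [[a b]] _ <-.
have r0 : 0 < r%:num by [].
rewrite /mscale nuE /pushforward /=.
have -> : affine r%:num c @^-1` `]a, b] = `](a - c) / r%:num, (b - c) / r%:num]%classic.
  apply/seteqP; split=> y /=; rewrite /affine !in_itv/= ltr_pdivrMr// ler_pdivlMr// mulrC;
    by move=> /andP[H1 H2]; apply/andP; split; move: H1 H2; lra.
rewrite !lebesgue_measure_itv/= !lte_fin ltr_pM2r ?invr_gt0// ltrD2r.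
case: ifPn => _; last by rewrite mule0.
by rewrite -!EFinD -EFinM; congr (_%:E); field; rewrite gt_eqF.
Qed.

Lemma ge0_integral_affine (r : {posnum R}) (c : R) (f : R -> \bar R) :
  measurable_fun setT f -> (forall y, 0 <= f y)%E ->
  (\int[mu]_y f y = r%:num%:E * \int[mu]_y f (r%:num * y + c)%R)%E.
Proof.
move=> mf f0.
have [nu nuE] : exists nu : {measure set (measurableTypeR R) -> \bar R},
    forall B, nu B = pushforward mu (affine r%:num c) B.
  by exists (measure_function_pushforward__canonical__measure_function_Measure
    mu (maffine r%:num c)).
transitivity (\int[mscale (r%:num%:nng)%R nu]_y f y)%E.
  apply: eq_measure_integral => B mB _ /=.
  by rewrite (lebesgue_measure_affine r c mB) /mscale nuE.
rewrite ge0_integral_mscale//; congr (_ * _)%E.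
transitivity (\int[pushforward mu (affine r%:num c)]_y f y)%E.
  by apply: eq_measure_integral => B mB _ /=; rewrite nuE.
by rewrite ge0_integral_pushforward.
Qed.

Lemma ge0_integral_shift (c : R) (f : R -> \bar R) :
  measurable_fun setT f -> (forall y, 0 <= f y)%E ->
  (\int[mu]_y f (y + c)%R = \int[mu]_y f y)%E.
Proof.
move=> mf f0; rewrite [RHS](ge0_integral_affine 1%:pos c)//= mul1e.
by under [RHS]eq_integral do rewrite mul1r.
Qed.

End AffineChange.

Section NormalIntegral.
Context {R : realType}.
Local Notation mu := (@lebesgue_measure R).

Lemma ge0_integral_normal_prob (m s : R) (f : R -> \bar R) :
  measurable_fun setT f -> (forall y, 0 <= f y)%E ->
  (\int[normal_prob m s]_x f x = \int[mu]_x (f x * (normal_pdf m s x)%:E))%E.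
Proof.
move=> mf f0; have dom := normal_prob_dominates m s.
rewrite -(Radon_Nikodym_SigmaFinite.change_of_variables dom)//.
have irn := Radon_Nikodym_SigmaFinite.f_integrable dom.
have mrn := measurable_int _ irn.
have mpdf : measurable_fun setT (fun x => (normal_pdf m s x)%:E : \bar R).
  by apply/measurable_EFinP; exact: measurable_normal_pdf.
apply: ae_eq_integral => //; [exact: emeasurable_funM..|].
apply: ae_eqe_mul2l; apply: integral_ae_eq => // E _ mE.
by rewrite -(Radon_Nikodym_SigmaFinite.f_integral dom).
Qed.

Lemma normal_probE (m s : R) (A : set R) : measurable A ->
  (normal_prob m s A = \int[mu]_x ((\1_A x)%:E * (normal_pdf m s x)%:E))%E.
Proof.
move=> mA; rewrite -ge0_integral_normal_prob.
- by rewrite integral_indic// setIT.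
- exact/measurable_EFinP/measurable_indic.
- by move=> y; rewrite lee_fin.
Qed.

Lemma normal_pdfZ (r x : R) : 0 < r ->
  r * normal_pdf 0 r (r * x) = normal_pdf 0 1 x.
Proof.
move=> r0; rewrite !normal_pdfE ?gt_eqF// /normal_peak /normal_fun !subr0.
rewrite expr1n mul1r -mulrnAr sqrtrM ?sqr_ge0// sqrtr_sqr gtr0_norm//.
rewrite invfM mulrA mulrA divff ?gt_eqF// mul1r; congr (_ * expR _).
by rewrite -[in LHS]mulr_natr -[in RHS]mulr_natr exprMn; field; rewrite gt_eqF.
Qed.

Lemma normal_probZ (r : R) (A : set R) : 0 < r -> measurable A ->
  normal_prob 0 1 [set x | A (r * x)] = normal_prob 0 r A.
Proof.
move=> r0 mA.
have mf : measurable_fun setT (fun x : R => r * x) by exact: measurable_funM.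
have mA' : measurable [set x | A (r * x)].
  by rewrite -[X in measurable X]setTI; exact: mf.
rewrite (normal_probE 0 1 mA') (normal_probE 0 r mA).
have mpdf s : measurable_fun setT (fun x => (normal_pdf 0 s x)%:E : \bar R).
  by apply/measurable_EFinP; exact: measurable_normal_pdf.
have mind (B : set R) : measurable B ->
    measurable_fun setT (fun x => (\1_B x)%:E : \bar R).
  by move=> mB; exact/measurable_EFinP/measurable_indic.
rewrite [RHS](ge0_integral_affine (PosNum r0) 0)/=; last 2 first.
- by apply: emeasurable_funM => //; exact: mind.
- by move=> y; rewrite mule_ge0// lee_fin ?normal_pdf_ge0.
under [in RHS]eq_integral do rewrite addr0.
rewrite -ge0_integralZl//; last 3 first.
- apply: emeasurable_funM.
    by apply/measurable_EFinP; apply: measurableT_comp mf; exact: measurable_indic.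
  by apply/measurable_EFinP; apply: measurableT_comp mf; exact: measurable_normal_pdf.
- by move=> y _; rewrite mule_ge0// lee_fin ?normal_pdf_ge0.
- by rewrite lee_fin ltW.
apply: eq_integral => x _; rewrite -(normal_pdfZ x r0) EFinM muleCA.
by congr (_ * (_%:E * _))%E; rewrite !indicE; congr (_%:R); rewrite !inE.
Qed.

Lemma normal_prob1 (m s x : R) : normal_prob m s [set x] = 0%E.
Proof.
have /null_content_dominatesP := normal_prob_dominates m s.
by apply=> //; exact: lebesgue_measure_set1.
Qed.

End NormalIntegral.

(** * Rotation invariance and linear forms of Gaussian vectors *)

Section GaussianPlane.
Context {R : realType}.
Local Notation mu := (@lebesgue_measure R).
Local Notation U := (measurableTypeR R).
Implicit Types (c s t : R) (F : U * U -> \bar R).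

Definition gauss2 : probability (U * U)%type R :=
  (normal_prob 0 1 \x normal_prob 0 1)%E.

Definition planerot c s (z : U * U) : U * U := (c * z.1 - s * z.2, s * z.1 + c * z.2).

Lemma measurable_lin2 (a b : R) :
  measurable_fun setT (fun z : U * U => a * z.1 + b * z.2).
Proof. by apply: measurable_funD; apply: measurable_funM. Qed.

Lemma measurable_rot c s : measurable_fun setT (planerot c s).
Proof.
apply/measurable_fun_pairP; split; rewrite /comp/=; last exact: measurable_lin2.
under eq_fun do rewrite -mulNr; exact: measurable_lin2.
Qed.

Definition plane_int F : \bar R := (\int[mu]_x \int[mu]_y F (x, y))%E.

(* A rotation is a product of three shears, each of which preserves the plane
   integral by translation invariance in one variable. *)
Let shear1 t (z : U * U) : U * U := (z.1 + t * z.2, z.2).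
Let shear2 t (z : U * U) : U * U := (z.1, z.2 + t * z.1).

Let mshear1 t : measurable_fun setT (shear1 t).
Proof.
apply/measurable_fun_pairP; split; last exact: measurable_snd.
rewrite /comp/=; under eq_fun do rewrite -[X in X + _]mul1r.
exact: measurable_lin2.
Qed.

Let mshear2 t : measurable_fun setT (shear2 t).
Proof.
apply/measurable_fun_pairP; split; first exact: measurable_fst.
rewrite /comp/=; under eq_fun do rewrite addrC -[X in _ + X]mul1r.
exact: measurable_lin2.
Qed.

Let plane_int_shear2 t F : measurable_fun setT F -> (forall z, 0 <= F z)%E ->
  plane_int (F \o shear2 t) = plane_int F.
Proof.
move=> mF F0; apply: eq_integral => x _ /=; rewrite /shear2/=.
rewrite (@ge0_integral_shift _ (t * x) (fun y => F (x, y)))//.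
exact: measurableT_comp.
Qed.

Let plane_int_shear1 t F : measurable_fun setT F -> (forall z, 0 <= F z)%E ->
  plane_int (F \o shear1 t) = plane_int F.
Proof.
move=> mF F0; rewrite /plane_int.
have F1 z : (0 <= (F \o shear1 t) z)%E by exact: F0.
have mF1 := measurableT_comp mF (mshear1 t).
apply: etrans (@fubini_tonelli _ _ _ _ _ mu mu (F \o shear1 t) mF1 F1) _.
apply: etrans (esym (@fubini_tonelli _ _ _ _ _ mu mu F mF F0)).
apply: eq_integral => y _ /=; rewrite /shear1/=.
rewrite (@ge0_integral_shift _ (t * y) (fun x => F (x, y)))//.
exact: measurableT_comp.
Qed.

Let plane_int_rot c s F : c ^+ 2 + s ^+ 2 = 1 -> measurable_fun setT F ->
  (forall z, 0 <= F z)%E -> plane_int (F \o planerot c s) = plane_int F.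
Proof.
wlog c1 : c s F / c != -1 => [H|].
  (* The shear parameter below has denominator [1 + c]. The excluded half turn is the square of a
     quarter turn. *)
  have [c1|c1] := eqVneq c (-1); last by apply: H.
  move=> cs mF F0.
  have s0 : s = 0.
    by apply/eqP; rewrite -sqrf_eq0; apply/eqP; move: cs; rewrite c1 sqrrN expr1n; lra.
  have E : planerot c s = planerot 0 1 \o planerot 0 1.
    apply/funext => z; rewrite /planerot /= c1 s0; congr (_, _); ring.
  have c0 : 0 != -1 :> R by rewrite eq_sym oppr_eq0 oner_eq0.
  have cs01 : 0 ^+ 2 + 1 ^+ 2 = 1 :> R by rewrite expr0n expr1n add0r.
  have mFr := measurableT_comp mF (measurable_rot 0 1).
  have F0r z : (0 <= (F \o planerot 0 1) z)%E by exact: F0.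
  have -> : F \o planerot c s = (F \o planerot 0 1) \o planerot 0 1 by rewrite E compA.
  have rotF := H 0 1 F c0 cs01 mF F0; rewrite -[RHS]rotF.
  exact: (H 0 1 (F \o planerot 0 1) c0 cs01 mFr F0r).
(* [tau] is the tangent of half the rotation angle. *)
move=> cs mF F0; pose tau := s / (1 + c).
have c1' : 1 + c != 0 by rewrite addrC addr_eq0.
have E : planerot c s = shear1 (- tau) \o shear2 s \o shear1 (- tau).
  apply/funext => z; rewrite /planerot /shear1 /shear2/=.
  have ts : tau * s = 1 - c.
    apply: (mulIf c1'); rewrite /tau mulrAC divfK//.
    by move: cs; rewrite !expr2; lra.
  have tc : tau * c = s - tau.
    by apply: (mulIf c1'); rewrite /tau mulrBl mulrAC divfK//; ring.
  congr (_, _).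
    transitivity ((1 - tau * s) * z.1 - (tau + tau * c) * z.2).
      by rewrite ts tc; ring.
    rewrite -[X in tau + X * c]/tau.
    have -> : tau * c = tau * (1 - tau * s) by rewrite ts; congr (_ * _); ring.
    by ring.
  have -> : c = 1 - tau * s by rewrite ts; ring.
  by ring.
have m1 := measurableT_comp mF (mshear1 (- tau)).
have m2 := measurableT_comp m1 (mshear2 s).
have -> : F \o planerot c s = F \o shear1 (- tau) \o shear2 s \o shear1 (- tau).
  by rewrite E !compA.
have F1 z : (0 <= (F \o shear1 (- tau)) z)%E by exact: F0.
have F2 z : (0 <= (F \o shear1 (- tau) \o shear2 s) z)%E by exact: F0.
apply: etrans (plane_int_shear1 _ m2 F2) _.
apply: etrans (plane_int_shear2 _ m1 F1) _.
exact: plane_int_shear1.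
Qed.

Let gauss2E A : measurable A -> gauss2 A = plane_int (fun z =>
  (\1_A z)%:E * (normal_pdf 0 1 z.1 * normal_pdf 0 1 z.2)%:E)%E.
Proof.
move=> mA.
transitivity (\int[normal_prob 0 1]_x (normal_prob 0 1 (xsection A x)))%E => //.
rewrite ge0_integral_normal_prob//; last exact: measurable_fun_xsection.
apply: eq_integral => x _ /=.
have mx : measurable (xsection A x) by exact: measurable_xsection.
rewrite normal_probE// muleC -ge0_integralZl//.
- apply: eq_integral => y _.
  rewrite muleCA EFinM; congr (_%:E * _)%E.
  by rewrite !indicE; congr (_%:R); rewrite mem_xsection.
- apply: emeasurable_funM; first exact/measurable_EFinP/measurable_indic.
  by apply/measurable_EFinP; exact: measurable_normal_pdf.
- by move=> y _; rewrite mule_ge0// lee_fin ?normal_pdf_ge0.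
- by rewrite lee_fin normal_pdf_ge0.
Qed.

Let pdf2E (a b : R) : normal_pdf 0 1 a * normal_pdf 0 1 b =
  normal_peak (1 : R) ^+ 2 * expR (- (a ^+ 2 + b ^+ 2) / 2).
Proof.
rewrite !normal_pdfE ?oner_eq0// /normal_fun mulrACA -expr2 -expRD.
by congr (_ * expR _); rewrite !subr0 expr1n; field.
Qed.

Lemma gauss2_rot c s A : c ^+ 2 + s ^+ 2 = 1 -> measurable A ->
  gauss2 (planerot c s @^-1` A) = gauss2 A.
Proof.
move=> cs mA.
have mrA : measurable (planerot c s @^-1` A).
  by rewrite -[X in measurable X]setTI; apply: measurable_rot.
pose F (z : U * U) : \bar R :=
  ((\1_A z)%:E * (normal_pdf 0 1 z.1 * normal_pdf 0 1 z.2)%:E)%E.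
have mF : measurable_fun setT F.
  apply: emeasurable_funM; first exact/measurable_EFinP/measurable_indic.
  apply/measurable_EFinP; apply: measurable_funM.
    by apply: measurableT_comp (@measurable_fst _ _ _ _); exact: measurable_normal_pdf.
  by apply: measurableT_comp (@measurable_snd _ _ _ _); exact: measurable_normal_pdf.
have F0 z : (0 <= F z)%E.
  by rewrite mule_ge0// lee_fin ?mulr_ge0 ?normal_pdf_ge0.
apply: etrans (gauss2E mrA) _; apply: etrans (esym (gauss2E mA)).
apply: etrans (plane_int_rot cs mF F0); congr plane_int.
apply/funext => z; rewrite /F /= pdf2E pdf2E.
have -> : (c * z.1 - s * z.2) ^+ 2 + (s * z.1 + c * z.2) ^+ 2 = z.1 ^+ 2 + z.2 ^+ 2.
  by rewrite -[RHS]mul1r -cs; ring.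
by [].
Qed.

Lemma gauss2_fst A : measurable A -> gauss2 [set z | A z.1] = normal_prob 0 1 A.
Proof.
move=> mA; have -> : [set z : U * U | A z.1] = A `*` setT.
  by apply/seteqP; split=> z //= [].
by rewrite /gauss2/= product_measure1E// [X in (_ * X)%E]probability_setT mule1.
Qed.

(** A rotation carries the linear form to its norm times the first coordinate, whose law is
    known. *)
Lemma gauss2_lin (a b : R) A : measurable A ->
  gauss2 [set z | A (a * z.1 + b * z.2)] =
  normal_prob 0 1 [set x | A (Num.sqrt (a ^+ 2 + b ^+ 2) * x)].
Proof.
move=> mA; set r := Num.sqrt _.
have mrA : measurable [set x : R | A (r * x)].
  by rewrite -[X in measurable X]setTI; apply: measurable_funM.
have mB : measurable [set z : U * U | A (r * z.1)].
  rewrite -[X in measurable X]setTI.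
  exact: (@measurable_fst _ _ U U measurableT _ mrA).
have ab0 : 0 <= a ^+ 2 + b ^+ 2 by rewrite addr_ge0 ?sqr_ge0.
have r2 : r ^+ 2 = a ^+ 2 + b ^+ 2 by rewrite sqr_sqrtr.
have [c [s [cs E]]] : exists c s, c ^+ 2 + s ^+ 2 = 1 /\
    forall z : U * U, a * z.1 + b * z.2 = r * (planerot c s z).1.
  have [r0|rn0] := eqVneq r 0.
    exists 1, 0; rewrite expr1n expr0n addr0; split=> // z.
    move: r2; rewrite r0 expr0n => /esym/eqP.
    rewrite paddr_eq0 ?sqr_ge0// !sqrf_eq0 => /andP[/eqP-> /eqP->].
    by rewrite !mul0r addr0.
  exists (a / r), (- b / r); split; last by move=> z; rewrite /planerot/=; field.
  by rewrite !exprMn sqrrN exprVn r2 -mulrDl divff// -r2 expf_neq0.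
apply: (etrans _ (gauss2_fst mrA)); apply: (etrans _ (gauss2_rot cs mB)).
apply: (congr1 (fun B => gauss2 B)).
by apply/seteqP; split=> z /=; rewrite E.
Qed.

End GaussianPlane.

Section GaussianSpace.
Context {R : realType}.
Local Notation U := (measurableTypeR R).
Implicit Types (a b c s : R).

Definition gauss4 : probability ((U * U) * (U * U))%type R :=
  (gauss2 \x gauss2)%E.

Definition rot2 c s c' s' (w : (U * U) * (U * U)) : (U * U) * (U * U) :=
  (planerot c s w.1, planerot c' s' w.2).

Lemma measurable_rot2 c s c' s' : measurable_fun setT (rot2 c s c' s').
Proof.
apply/measurable_fun_pairP; split.
  exact: measurableT_comp (measurable_rot c s) (@measurable_fst _ _ _ _).
exact: measurableT_comp (measurable_rot c' s') (@measurable_snd _ _ _ _).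
Qed.

Lemma gauss4E A : gauss4 A = (\int[gauss2]_g gauss2 (xsection A g))%E.
Proof. by []. Qed.

Lemma gauss4_rot2 c s c' s' A : c ^+ 2 + s ^+ 2 = 1 -> c' ^+ 2 + s' ^+ 2 = 1 ->
  measurable A -> gauss4 (rot2 c s c' s' @^-1` A) = gauss4 A.
Proof.
move=> cs cs' mA; rewrite !gauss4E.
transitivity (\int[gauss2]_g gauss2 (xsection A (planerot c s g)))%E.
  apply: eq_integral => g _.
  apply: etrans (gauss2_rot cs' (measurable_xsection _ mA)).
  apply: (congr1 (fun B => gauss2 B)).
  by apply/seteqP; split=> h /=; rewrite !xsectionE.
pose k g := gauss2 (xsection A g).
have mk : measurable_fun setT k by exact: measurable_fun_xsection.
transitivity (\int[pushforward gauss2 (planerot c s)]_g k g)%E.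
  apply/esym/(@ge0_integral_pushforward _ _ _ _ R (planerot c s) _ gauss2 setT k) => //.
  exact: measurable_rot.
apply: eq_measure_integral; first exact: measurable_rot.
by move=> ? B mB _; exact: (gauss2_rot cs mB).
Qed.

(** Each pair is replaced by a single normal variable with factor [r1] or [r2]; the planar case then
    applies once more to these two variables. *)
Lemma gauss4_lin a b c d A : measurable A ->
  gauss4 [set w | A (a * w.1.1 + b * w.1.2 + (c * w.2.1 + d * w.2.2))] =
  normal_prob 0 1 [set x | A (Num.sqrt (a ^+ 2 + b ^+ 2 + (c ^+ 2 + d ^+ 2)) * x)].
Proof.
move=> mA; rewrite gauss4E.
set r1 := Num.sqrt (a ^+ 2 + b ^+ 2); set r2 := Num.sqrt (c ^+ 2 + d ^+ 2).
pose B : set (U * U) := [set z | A (z.1 + r2 * z.2)].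
have mB : measurable B.
  rewrite -[X in measurable X]setTI /B.
  have := @measurable_lin2 _ 1 r2.
  under eq_fun do rewrite mul1r.
  exact.
pose k (x : U) := normal_prob 0 1 (xsection B x).
have mk : measurable_fun setT k by exact: measurable_fun_xsection.
have mr1 : measurable_fun setT (fun x : U => r1 * x : U) by apply: measurable_funM.
transitivity (\int[gauss2]_g k (a * g.1 + b * g.2)%R)%E.
  apply: eq_integral => g _.
  pose A' := [set y | A (a * g.1 + b * g.2 + y)].
  have mA' : measurable A'.
    by rewrite -[X in measurable X]setTI; apply: measurable_funD.
  apply: (etrans _ (etrans (gauss2_lin c d mA') _)).
    apply: (congr1 (fun B => gauss2 B)).
    by apply/seteqP; split=> h /=; rewrite xsectionE.
  apply: (congr1 (fun B => normal_prob 0 1 B)).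
  by apply/seteqP; split=> h /=; rewrite xsectionE.
transitivity (\int[pushforward gauss2 (fun g : U * U => (a * g.1 + b * g.2)%R : U)]_x k x)%E.
  apply/esym/(@ge0_integral_pushforward _ _ _ _ R
    (fun g : U * U => a * g.1 + b * g.2 : U) _ gauss2 setT k) => //.
  exact: measurable_lin2.
transitivity (\int[pushforward (normal_prob 0 1) (fun x : U => (r1 * x)%R : U)]_x k x)%E.
  apply: eq_measure_integral; first exact: measurable_lin2.
  by move=> ? E mE _; exact: (gauss2_lin a b mE).
apply: (etrans (@ge0_integral_pushforward _ _ _ _ R (fun x : U => r1 * x : U)
  mr1 (normal_prob 0 1) setT k _ _ _)) => //.
transitivity (gauss2 [set z | A (r1 * z.1 + r2 * z.2)]).
  apply: eq_integral => x _ /=; apply: (congr1 (fun B => normal_prob 0 1 B)).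
  by apply/seteqP; split=> h /=; rewrite !xsectionE.
apply: (etrans (gauss2_lin r1 r2 mA)).
by rewrite !sqr_sqrtr// addr_ge0 ?sqr_ge0.
Qed.

Lemma gauss4_lin_gaussian a b c d : exists s : R, 0 <= s /\
  forall A : set R, measurable A ->
    gauss4 [set w | A (a * w.1.1 + b * w.1.2 + (c * w.2.1 + d * w.2.2))] =
    gaussian_law 0 s A.
Proof.
exists (Num.sqrt (a ^+ 2 + b ^+ 2 + (c ^+ 2 + d ^+ 2))); rewrite sqrtr_ge0; split=> // A mA.
rewrite gauss4_lin// /gaussian_law; set r := Num.sqrt _.
have [->|r0] := eqVneq r 0; last by rewrite normal_probZ// lt_neqAle eq_sym r0 sqrtr_ge0.
have -> : [set x | A (0 * x)] = [set _ | A 0].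
  by apply/seteqP; split=> x /=; rewrite mul0r.
rewrite diracE; have [A0|nA0] := pselect (A 0).
  have -> : [set _ : R | A 0] = setT by apply/seteqP; split.
  by rewrite mem_set// probability_setT.
have -> : [set _ : R | A 0] = set0 by apply/seteqP; split.
by rewrite memNset// measure0.
Qed.

Lemma gauss4_lin_eq0 a b c d : a ^+ 2 + b ^+ 2 + (c ^+ 2 + d ^+ 2) != 0 ->
  gauss4 [set w | a * w.1.1 + b * w.1.2 + (c * w.2.1 + d * w.2.2) = 0] = 0%E.
Proof.
move=> n0; rewrite (@gauss4_lin a b c d [set 0])//; set r := Num.sqrt _.
have r0 : r != 0.
  by rewrite sqrtr_eq0 -ltNge lt_neqAle eq_sym n0 !addr_ge0 ?sqr_ge0.
rewrite (_ : [set x | _] = [set 0]); first exact: normal_prob1.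
apply/seteqP; split=> x /=; last by move=> ->; rewrite mulr0.
by move=> /eqP; rewrite mulf_eq0 (negbTE r0) => /eqP.
Qed.

(* Fubini over the last coordinate. *)
Lemma gauss4_null (A : set ((U * U) * (U * U))) : measurable A ->
  (forall g x y y', A (g, (x, y)) -> A (g, (x, y')) -> y = y') -> gauss4 A = 0%E.
Proof.
move=> mA A1; rewrite gauss4E integral0_eq// => g _.
have mAg : measurable (xsection A g) by exact: measurable_xsection.
transitivity (\int[normal_prob 0 1]_x normal_prob 0 1 (xsection (xsection A g) x))%E => //.
rewrite integral0_eq// => x _.
have mAgx : measurable (xsection (xsection A g) x) by exact: measurable_xsection.
have [E|/set0P[y Ay]] := eqVneq (xsection (xsection A g) x) set0.
  by rewrite E measure0.
apply/eqP; rewrite -measure_le0 -(normal_prob1 0 1 y).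
apply: le_measure; rewrite ?inE//.
by move=> y'; move: Ay; rewrite !xsectionE /= => /A1 /[apply] ->.
Qed.

End GaussianSpace.

(** * Measurability through countable unions and rational times *)

Section CountableUnions.
Context (d : measure_display) (T : measurableType d) (R : realType).
Variables (I : countType) (D : set I) (F : I -> set T).

Let Fn (k : nat) : set T :=
  if unpickle k is Some i then [set x | D i /\ F i x] else set0.

Let bigcup_Fn : \bigcup_(i in D) F i = \bigcup_k Fn k.
Proof.
apply/seteqP; split=> x [i].
  by move=> Di Fi; exists (pickle i) => //; rewrite /Fn pickleK.
by rewrite /Fn; case: unpickle => [j|//] _ [Dj Fj]; exists j.
Qed.

Lemma bigcup_count_measurable : (forall i, D i -> measurable (F i)) ->
  measurable (\bigcup_(i in D) F i).
Proof.
move=> mF; rewrite bigcup_Fn; apply: bigcupT_measurable => k.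
rewrite /Fn; case: unpickle => [i|]; last exact: measurable0.
have [Di|nDi] := pselect (D i).
  by rewrite (_ : [set x | _] = F i); [exact: mF|apply/seteqP; split=> x // []].
by rewrite (_ : [set x | _] = set0); [|apply/seteqP; split=> x // []].
Qed.

Lemma bigcup_count_negligible (mu : {measure set T -> \bar R}) :
  (forall i, D i -> mu.-negligible (F i)) -> mu.-negligible (\bigcup_(i in D) F i).
Proof.
move=> nF; rewrite bigcup_Fn; apply: negligible_bigcup => k.
rewrite /Fn; case: unpickle => [i|]; last exact: negligible_set0.
have [Di|nDi] := pselect (D i).
  by apply: negligibleS (nF i Di) => x [].
by apply: negligibleS (@negligible_set0 _ _ _ mu) => x [].
Qed.

End CountableUnions.

Section ContinuousPaths.
Context (d : measure_display) (T : measurableType d) (R : realType).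
Variable X : R -> T -> R.
Hypotheses (cX : continuous_paths X) (mX : forall t, measurable_fun setT (X t)).

Lemma continuous_paths_usc : usc_paths X.
Proof. by move=> w; apply: continuous_usc; exact: cX. Qed.

Lemma rational_gt a b c w : a <= b -> c < path_sup X a b w ->
  c < X a w \/ exists q : rat, a < ratr q < b /\ c < X (ratr q) w.
Proof.
move=> ab; have uw : usc (X^~ w) by exact: continuous_paths_usc.
have [s /andP[as_ sb] sE] := seg_sup_attained uw ab.
rewrite (_ : path_sup X a b w = X s w) => [cs|]; last by rewrite sE.
move: as_; rewrite le_eqVlt => /predU1P[->|as_]; [by left|right].
have [/= e e0 He] : \forall t \near s, c < X t w.
  by have /cvgr_gt := @cX w s; exact.
(* The rational time is taken to the left of [s], which stays inside the segment even for [s = b];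
   only the end [a] needs its own case. *)
have mlt : Num.max a (s - e) < s by rewrite gt_max as_/=; lra.
have [q] := rat_in_itvoo mlt; rewrite in_itv/= gt_max => /andP[/andP[aq eq] qs].
exists q; split; first by rewrite aq; lra.
by apply: He; rewrite /= gtr0_norm; lra.
Qed.

Lemma measurable_path_sup_continuous a b : a <= b ->
  measurable_fun setT (path_sup X a b).
Proof.
move=> ab mT; apply: (measurability _ (RGenOInfty.measurableE R)) => //.
move=> _ [_ [c ->] <-]; rewrite setTI.
have -> : path_sup X a b @^-1` `]c, +oo[ = [set w | c < X a w] `|`
    \bigcup_(q in [set q : rat | a < ratr q < b]) [set w | c < X (ratr q) w].
  apply/seteqP; split=> w; rewrite /= in_itv/= andbT.
    by move=> /(rational_gt ab)[|[q [qab cq]]]; [left|right; exists q].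
  have uw : usc (X^~ w) by exact: continuous_paths_usc.
  case=> [cw|[q /= qab cq]]; first by apply: lt_le_trans cw (seg_sup_ub uw _); rewrite lexx.
  by apply: lt_le_trans cq (seg_sup_ub uw _); lra.
have mc t : measurable [set w | c < X t w].
  by apply: measurable_lt_set => //; exact: measurable_cst.
by apply: measurableU => //; apply: bigcup_count_measurable => q _.
Qed.

End ContinuousPaths.

(** * The two-tone Gaussian process: stationarity and uniqueness *)

Section TwoTone.
Context {R : realType}.
Local Notation U := (measurableTypeR R).
Local Notation Om := ((U * U) * (U * U))%type.
Implicit Types (al om sg s h : R) (w : Om).

(* [w.1] drives a fast tone of frequency [al] and [w.2] a slow one of frequency
   [om] and amplitude [sg]. The sine comes first in the slow tone, so that for
   small [om] its monotonicity near 0 is given by the sign of [w.2.1]. *)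
Definition two_tone al om sg s w : R :=
  w.1.1 * cos (al * s) + w.1.2 * sin (al * s) +
  sg * (w.2.1 * sin (om * s) + w.2.2 * cos (om * s)).

Lemma two_tone_lin al om sg s w : two_tone al om sg s w =
  cos (al * s) * w.1.1 + sin (al * s) * w.1.2 +
  (sg * sin (om * s) * w.2.1 + sg * cos (om * s) * w.2.2).
Proof. by rewrite /two_tone; ring. Qed.

(** A time shift rotates the two pairs of coefficients, so rotation invariance of [gauss4] yields
    stationarity. *)
Lemma two_tone_shift al om sg s h w : two_tone al om sg (s + h) w =
  two_tone al om sg s (rot2 (cos (al * h)) (- sin (al * h))
                            (cos (om * h)) (sin (om * h)) w).
Proof.
rewrite /two_tone /rot2 /planerot /= !mulrDr !cosD !sinD; ring.
Qed.

Section Process.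
Variables al om sg : R.
Local Notation X := (two_tone al om sg).

Lemma two_tone_continuous : continuous_paths X.
Proof.
have cmul (a : R) : continuous (fun s : R => a * s) by exact: mulrl_continuous.
have csin (a : R) : continuous (fun s : R => sin (a * s)).
  by move=> x; apply: (continuous_comp (f := fun s => a * s));
    [exact: cmul|exact: continuous_sin].
have ccos (a : R) : continuous (fun s : R => cos (a * s)).
  by move=> x; apply: (continuous_comp (f := fun s => a * s));
    [exact: cmul|exact: continuous_cos].
move=> w s; apply: cvgD.
  by apply: cvgD; (apply: cvgM; first exact: cvg_cst); [exact: ccos|exact: csin].
apply: cvgM; first exact: cvg_cst.
by apply: cvgD; (apply: cvgM; first exact: cvg_cst); [exact: csin|exact: ccos].
Qed.

Lemma measurable_lin4 (a b c d : R) : measurable_fun setT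
  (fun w : Om => a * w.1.1 + b * w.1.2 + (c * w.2.1 + d * w.2.2)).
Proof.
apply: measurable_funD.
  exact: measurableT_comp (measurable_lin2 a b) (@measurable_fst _ _ _ _).
exact: measurableT_comp (measurable_lin2 c d) (@measurable_snd _ _ _ _).
Qed.

Lemma measurable_lin4_eq0 (a b c d : R) : measurable
  [set w : Om | a * w.1.1 + b * w.1.2 + (c * w.2.1 + d * w.2.2) = 0].
Proof.
have mlin := measurable_lin4 a b c d.
have := mlin measurableT [set 0] (measurable_set1 0).
by rewrite setTI.
Qed.

Let first_coordE : [set w : Om | w.1.1 != 0] =
  ~` [set w : Om | 1 * w.1.1 + 0 * w.1.2 + (0 * w.2.1 + 0 * w.2.2) = 0].
Proof.
by apply/seteqP; split=> w /=; rewrite mul1r !mul0r !addr0 => /eqP.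
Qed.

Lemma measurable_first_coord_neq0 : measurable [set w : Om | w.1.1 != 0].
Proof. by rewrite first_coordE; apply: measurableC; exact: measurable_lin4_eq0. Qed.

(** Discards a null set that contains all paths with vanishing fast tone. *)
Lemma pr_first_coord_neq0 (A : set Om) : measurable A ->
  pr gauss4 A <= pr gauss4 (A `&` [set w | w.1.1 != 0]).
Proof.
move=> mA; have mZ := measurable_lin4_eq0 1 0 0 0.
have nz : 1 ^+ 2 + 0 ^+ 2 + (0 ^+ 2 + 0 ^+ 2) != 0 :> R.
  by rewrite !expr2 !mul0r !addr0 mul1r oner_eq0.
apply: (pr_setI_null mA mZ measurable_first_coord_neq0).
  by move=> w Nw; apply: contrapT => Zw; apply: Nw; rewrite first_coordE.
exact: (congr1 fine (gauss4_lin_eq0 nz)).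
Qed.

Lemma two_tone_measurable s : measurable_fun setT (X s).
Proof.
have -> : X s = fun w => cos (al * s) * w.1.1 + sin (al * s) * w.1.2 +
    (sg * sin (om * s) * w.2.1 + sg * cos (om * s) * w.2.2).
  by apply/funext => w; exact: two_tone_lin.
exact: measurable_lin4.
Qed.

Lemma two_tone_gaussian : gaussian_process gauss4 X.
Proof.
split; first exact: two_tone_measurable.
move=> n t c.
pose co := \sum_(i < n) c i * cos (al * t i).
pose si := \sum_(i < n) c i * sin (al * t i).
pose si' := \sum_(i < n) c i * (sg * sin (om * t i)).
pose co' := \sum_(i < n) c i * (sg * cos (om * t i)).
have [s [s0 H]] := @gauss4_lin_gaussian R co si si' co'.
exists 0, s; split; first exact: s0.
move=> A mA; apply: (etrans _ (H A mA)).
apply: (congr1 (fun B => gauss4 B)).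
have E w : \sum_(i < n) c i * X (t i) w =
    co * w.1.1 + si * w.1.2 + (si' * w.2.1 + co' * w.2.2).
  rewrite /co /si /si' /co' !mulr_suml -!big_split /=.
  by apply: eq_bigr => i _; rewrite two_tone_lin; ring.
by apply/seteqP; split=> w /=; rewrite E.
Qed.

Lemma measurable_path_sup_two_tone a b : a <= b ->
  measurable_fun setT (path_sup X a b).
Proof.
apply: measurable_path_sup_continuous; first exact: two_tone_continuous.
exact: two_tone_measurable.
Qed.

Definition phase_shift h : Om -> Om :=
  rot2 (cos (al * h)) (- sin (al * h)) (cos (om * h)) (sin (om * h)).

Lemma gauss4_phase_shift h A : measurable A ->
  gauss4 (phase_shift h @^-1` A) = gauss4 A.
Proof.
by move=> mA; apply: gauss4_rot2; rewrite ?sqrrN// cos2Dsin2.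
Qed.

Lemma path_sup_phase_shift h a b w :
  path_sup X (a + h) (b + h) w = path_sup X a b (phase_shift h w).
Proof.
apply: (etrans (esym (seg_sup_shift (X^~ w) h a b))).
apply: (congr1 (fun f => seg_sup f a b)).
by apply/funext => s; exact: two_tone_shift.
Qed.

Lemma two_tone_stationary : stationary gauss4 X.
Proof.
split; first exact: measurable_path_sup_two_tone.
move=> n a b h ab A mA; rewrite /pushforward.
have mS : measurable (path_sups X a b @^-1` A).
  rewrite -[Y in measurable Y]setTI.
  have mf : measurable_fun setT (path_sups X a b).
    apply/measurable_fun_tnthP => i.
    have -> : (@tnth _ _ ^~ i) \o path_sups X a b = path_sup X (a i) (b i).
      by apply/funext => w /=; rewrite tnth_mktuple.
    exact: measurable_path_sup_two_tone.
  exact: mf.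
apply: (etrans _ (gauss4_phase_shift h mS)).
apply: (congr1 (fun B => gauss4 B)); apply/seteqP; split=> w /=;
  rewrite (_ : path_sups _ _ _ w = path_sups X a b (phase_shift h w))//;
  by apply: eq_from_tnth => i; rewrite !tnth_mktuple path_sup_phase_shift.
Qed.

Section Unique.
Variable T : R.
Hypotheses (T0 : 0 < T) (sg0 : 0 < sg) (om0 : 0 < om) (omT : om * T < pi).

Lemma cos_slow_lt x y : 0 <= x -> x < y -> y <= T -> cos (om * y) < cos (om * x).
Proof.
move=> x0 xy yT.
have omy : om * y <= om * T by rewrite ler_pM2l.
have omx : om * x < om * y by rewrite ltr_pM2l.
have omx0 : 0 <= om * x by rewrite mulr_ge0// ltW.
have ypi : om * y <= pi := le_trans omy (ltW omT).
have y0 : 0 <= om * y := le_trans omx0 (ltW omx).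
have xpi : om * x <= pi := le_trans (ltW omx) ypi.
by rewrite ltr_cos// in_itv/= ?omx0 ?y0.
Qed.

Lemma measurable_tie p q : 0 <= p -> q <= T ->
  measurable [set w | path_sup X 0 p w = path_sup X q T w].
Proof.
move=> p0 qT; have -> : [set w | path_sup X 0 p w = path_sup X q T w] =
    [set w | path_sup X 0 p w <= path_sup X q T w] `&`
    [set w | path_sup X q T w <= path_sup X 0 p w].
  apply/seteqP; split=> w /= => [->//|[H1 H2]].
  by apply/eqP; rewrite eq_le H1.
by apply: measurableI; apply: measurable_le_set;
  apply: measurable_path_sup_two_tone.
Qed.

(** Raising the last coefficient adds a positive multiple [D] of [cos (om * s)], which decreases on
    [[0, T]]. The left supremum gains at least [D * cos (om * p)] and the right one at most
    [D * cos (om * q)], which is less. Hence at most one value of this coefficient produces a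
    tie. *)
Lemma two_tone_no_tie p q : 0 < p -> p < q -> q < T ->
  gauss4 [set w | path_sup X 0 p w = path_sup X q T w] = 0%E.
Proof.
move=> p0 pq qT; apply: gauss4_null.
  by apply: measurable_tie; lra.
move=> g x; have main y y' : y < y' ->
    path_sup X 0 p (g, (x, y)) = path_sup X q T (g, (x, y)) ->
    path_sup X 0 p (g, (x, y')) = path_sup X q T (g, (x, y')) -> False.
  move=> yy E E'; pose D := sg * (y' - y).
  have D0 : 0 < D by rewrite mulr_gt0// subr_gt0.
  have XD s : X s (g, (x, y')) = X s (g, (x, y)) + D * cos (om * s).
    by rewrite /two_tone /D/=; ring.
  have uX w : usc (X^~ w).
    by apply: continuous_usc; exact: two_tone_continuous.
  have cosqp := @cos_slow_lt p q (ltW p0) pq (ltW qT).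
  have H1 : path_sup X 0 p (g, (x, y)) + D * cos (om * p) <=
      path_sup X 0 p (g, (x, y')).
    rewrite -lerBrDr; apply/(seg_sup_leP (uX _) _ (ltW p0)) => s sp.
    rewrite lerBrDr; apply: le_trans (seg_sup_ub (uX _) sp).
    rewrite XD lerD2l ler_pM2l//.
    have [->//|sp'] := eqVneq s p.
    by apply/ltW/cos_slow_lt; lra.
  have H2 : path_sup X q T (g, (x, y')) <=
      path_sup X q T (g, (x, y)) + D * cos (om * q).
    apply/(seg_sup_leP (uX _) _ (ltW qT)) => s sq.
    rewrite XD; apply: lerD; first exact: (seg_sup_ub (uX _) sq).
    rewrite ler_pM2l//; have [->//|sq'] := eqVneq s q.
    by apply/ltW/cos_slow_lt; lra.
  have : D * cos (om * q) < D * cos (om * p) by rewrite ltr_pM2l.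
  by move: H1 H2; rewrite E E'; lra.
move=> y y' H H'; have [yy|yy|//] := ltgtP y y'.
  by case: (main y y' yy H H').
by case: (main y' y yy H' H).
Qed.

(** Two locations can be separated by two rationals, which forces one of countably many null
    ties. *)
Lemma two_tone_unique : unique_sup_location gauss4 X T.
Proof.
have uX w : usc (X^~ w) by apply: continuous_usc; exact: two_tone_continuous.
pose tie (q : rat * rat) := [set w | path_sup X 0 (ratr q.1) w = path_sup X (ratr q.2) T w].
pose ok := [set q : rat * rat | [/\ 0 < (ratr q.1 : R),
  (ratr q.1 : R) < ratr q.2 & (ratr q.2 : R) < T]].
apply: (@negligibleS _ _ _ _ (\bigcup_(q in ok) tie q)).
  move=> w /= nun; apply: contrapT => ntie; apply: nun.
  have [s sT sE] := seg_sup_attained (uX w) (ltW T0).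
  exists s; split=> // s' [s'T s'E].
  have key x y : x < y -> sup_locations X T w x -> sup_locations X T w y -> False.
    move=> xy [xT xE] [yT yE]; have [q1] := rat_in_itvoo xy.
    rewrite in_itv/= => /andP[xq qy]; have [q2] := rat_in_itvoo qy.
    rewrite in_itv/= => /andP[qq qy2]; apply: ntie; exists (q1, q2).
      by split=> /=; lra.
    apply: (@etrans _ _ (path_sup X 0 T w)).
      apply/eqP; rewrite eq_le; apply/andP; split.
        by apply: (seg_sup_sub (uX w)); lra.
      by rewrite -xE; apply: (seg_sup_ub (uX w)); lra.
    apply/eqP; rewrite eq_le; apply/andP; split.
      by rewrite -yE; apply: (seg_sup_ub (uX w)); lra.
    by apply: (seg_sup_sub (uX w)); lra.
  have Ls : sup_locations X T w s by split.
  have Ls' : sup_locations X T w s' by split.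
  have [ss|ss|//] := ltgtP s s'; first by case: (key s s').
  by case: (key s' s).
apply: bigcup_count_negligible => -[q1 q2] [q0 qq qT].
have mt : measurable (tie (q1, q2)) by apply: measurable_tie; lra.
exists (tie (q1, q2)); split=> //; exact: two_tone_no_tie.
Qed.

End Unique.
End Process.
End TwoTone.

(** * Finiteness of the rate of local maxima *)

Section RateLimit.
Context {R : realType}.

(** As in Fekete's lemma, the limit is the supremum of the quotients: covering a nearly optimal [e0]
    by about [e0 / e] windows of length [e] bounds the quotient at [e] from below. *)
Lemma subadditive_rate_limit (p : R -> R) (C l : R) : 0 < l ->
  (forall e, 0 < e -> 0 <= p e) ->
  (forall e, 0 < e -> e < l -> p e <= C * e) ->
  (forall e e' n, 0 < e -> e' < n.+1%:R * e -> p e' <= n.+1%:R * p e) ->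
  exists L : R, e^-1 * p e @[e --> 0^'+] --> L.
Proof.
move=> l0 p0 pC sub.
pose Q := [set e^-1 * p e | e in [set e | 0 < e < l]].
have ubQ e : 0 < e < l -> e^-1 * p e <= C.
  by move=> /andP[e0 el]; rewrite ler_pdivrMl// mulrC pC.
have supQ : has_sup Q.
  split; first by exists ((l / 2)^-1 * p (l / 2)); exists (l / 2) => //=; lra.
  by exists C => _ [e /= /ubQ ? <-].
exists (sup Q); apply/cvgrPdist_le => eps eps0.
have eps2 : 0 < eps / 2 by lra.
have [_ [e0 /= /andP[e00 e0l] <-] He0] := sup_adherent eps2 supQ.
near=> e.
have e_gt0 : 0 < e by near: e; exact: nbhs_right_gt.
have el : e < l by near: e; exact: nbhs_right_lt.
have eC : e * `|C| <= e0 * (eps / 2).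
  have C1 : 0 < `|C| + 1 by rewrite ltr_pwDr.
  have : e < e0 * (eps / 2) / (`|C| + 1).
    by near: e; apply: nbhs_right_lt; rewrite divr_gt0// mulr_gt0.
  rewrite ltr_pdivlMr// mulrDr mulr1; have := e_gt0; lra.
rewrite ler_distlC; apply/andP; split; last first.
  have : e^-1 * p e <= sup Q.
    by apply: sup_upper_bound => //; exists e => //=; rewrite e_gt0.
  lra.
pose n := Num.truncn (e0 / e).
have /andP[n1 n2] : n%:R * e <= e0 < n.+1%:R * e.
  rewrite -ler_pdivlMr// -ltr_pdivrMr// truncn_itv//.
  by rewrite divr_ge0// ltW.
have H := sub e e0 n e_gt0 n2.
set q := e^-1 * p e.
have pq : p e = e * q by rewrite /q mulrA divff ?mul1r// gt_eqF.
have q0 : 0 <= q by rewrite mulr_ge0 ?invr_ge0 ?p0// ltW.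
have qC : q <= `|C| by apply: le_trans (ler_norm _); apply: ubQ; rewrite e_gt0.
have H2 : (e0 + e) * q >= p e0.
  apply: (le_trans H); rewrite pq mulrA ler_wpM2r//.
  by rewrite -natr1 mulrDl mul1r; lra.
have H3 : (sup Q - eps / 2) * e0 < p e0.
  by rewrite -ltr_pdivlMr// [X in _ < X]mulrC.
have H4 : e * q <= e0 * (eps / 2).
  by apply: le_trans eC; rewrite ler_pM2l.
have : e0 * (sup Q - eps) <= e0 * q.
  have : e0 * (sup Q - eps) = (sup Q - eps / 2) * e0 - e0 * (eps / 2) by field.
  by move: H2; rewrite mulrDl; lra.
by rewrite ler_pM2l.
Unshelve. all: by end_near.
Qed.

Let last_mark (b : nat -> bool) m n : (m < \sum_(k < n) b k)%N ->
  exists j, [/\ (j < n)%N, b j & (m <= \sum_(k < j) b k)%N].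
Proof.
elim: n => [|n IH]; first by rewrite big_ord0.
rewrite big_ord_recr/=; case bn: (b n).
  by rewrite addn1 ltnS => le; exists n; rewrite ltnSn.
by rewrite addn0 => /IH[j [jn bj mj]]; exists j; split=> //; exact: ltnW.
Qed.

Lemma at_most_three (b : nat -> bool) n :
  (forall i j k l : nat, (i < j)%N -> (j < k)%N -> (k < l)%N ->
     b i -> b j -> b k -> b l -> False) ->
  (\sum_(k < n) b k <= 3)%N.
Proof.
move=> H; rewrite leqNgt; apply/negP => /last_mark[l [_ bl]].
move=> /last_mark[k [kl bk]] /last_mark[j [jk bj]] /last_mark[i [ij bi _]].
exact: H ij jk kl bi bj bk bl.
Qed.

End RateLimit.

Section Zeros.
Context {R : realType}.
Implicit Types (a b c d al om s x y z l : R).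

Definition tone a b al s : R := a * cos (al * s) + b * sin (al * s).

Lemma is_derive_tone a b al s :
  is_derive s 1 (tone a b al) (tone (al * b) (- (al * a)) al s).
Proof.
have dlin : is_derive s 1 (fun x : R => al * x) al.
  by apply: is_derive_eq; rewrite /GRing.scale/= mulr1.
have dcos : is_derive s 1 (fun x : R => cos (al * x)) (- sin (al * s) * al).
  exact: (@is_derive1_comp R cos _ s _ _ (is_derive_cos _) dlin).
have dsin : is_derive s 1 (fun x : R => sin (al * x)) (cos (al * s) * al).
  exact: (@is_derive1_comp R sin _ s _ _ (is_derive_sin _) dlin).
have D := is_deriveD (is_deriveZ a dcos) (is_deriveZ b dsin).
apply: (is_derive_eq D).
rewrite /tone /GRing.scale/=; ring.
Qed.

Lemma Rolle_derive (f df : R -> R) x y : x < y ->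
  (forall s, x <= s <= y -> is_derive s 1 f (df s)) -> f x = f y ->
  exists2 z, x < z < y & df z = 0.
Proof.
move=> xy Df fxy.
have derf s : s \in `[x, y] -> derivable f s 1.
  by rewrite in_itv/= => /Df[].
have [z|||z zxy Dz] := @Rolle R f x y xy.
- by rewrite in_itv/= => zxy; apply: derf; rewrite in_itv/=; lra.
- exact: derivable_within_continuous.
- by [].
move: zxy; rewrite in_itv/= => zxy; exists z => //.
by have [|_ <-] := Df z; [lra|have [_ ->] := Dz].
Qed.

(** The zeros give a linear system for [a] and [b] with determinant [sin (al * (y - x))]. *)
Lemma tone_two_zeros a b al x y : 0 < al -> x < y -> al * (y - x) < pi ->
  tone a b al x = 0 -> tone a b al y = 0 -> a = 0 /\ b = 0.
Proof.
move=> al0 xy alxy; rewrite /tone => Ex Ey.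
have D : 0 < sin (al * (y - x)).
  by apply: sin_gt0_pi; rewrite alxy mulr_gt0// subr_gt0.
have DE : sin (al * (y - x)) = sin (al * y) * cos (al * x) - cos (al * y) * sin (al * x).
  by rewrite mulrBr sinD cosN sinN; ring.
have Da : a * sin (al * (y - x)) = 0.
  transitivity ((a * cos (al * x) + b * sin (al * x)) * sin (al * y) -
     (a * cos (al * y) + b * sin (al * y)) * sin (al * x)); first by rewrite DE; ring.
  by rewrite Ex Ey; ring.
have Db : b * sin (al * (y - x)) = 0.
  transitivity ((a * cos (al * y) + b * sin (al * y)) * cos (al * x) -
     (a * cos (al * x) + b * sin (al * x)) * cos (al * y)); first by rewrite DE; ring.
  by rewrite Ex Ey; ring.
by split; apply/eqP; [move/eqP: Da|move/eqP: Db]; rewrite mulf_eq0 (gt_eqF D) orbF.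
Qed.

(* Division by [cos (al * s)] and two applications of Rolle's theorem
   annihilate the fast tone and leave a multiple of the slow one. *)
Lemma two_tones_four_zeros a b c d al om l x1 x2 x3 x4 :
  0 < om -> om < al -> al * l < pi / 2 ->
  0 <= x1 -> x1 < x2 -> x2 < x3 -> x3 < x4 -> x4 <= l ->
  let f s := tone a b al s + tone c d om s in
  f x1 = 0 -> f x2 = 0 -> f x3 = 0 -> f x4 = 0 -> a = 0 /\ b = 0.
Proof.
move=> om0 omal all x10 x12 x23 x34 x4l f f1 f2 f3 f4.
have al0 : 0 < al by lra.
have cpos s : 0 <= s -> s <= l -> 0 < cos (al * s).
  move=> s0 sl; apply: cos_gt0_pihalf.
  have : al * s <= al * l by rewrite ler_pM2l.
  have : 0 <= al * s by rewrite mulr_ge0// ltW.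
  by have := pi_gt0 R; move=> *; apply/andP; split; lra.
pose f' s := tone (al * b) (- (al * a)) al s + tone (om * d) (- (om * c)) om s.
have Df s : is_derive s 1 f (f' s).
  exact: (is_deriveD (is_derive_tone a b al s) (is_derive_tone c d om s)).
pose C s := tone 1 0 al s.
have CE s : C s = cos (al * s) by rewrite /C /tone mul1r mul0r addr0.
pose S s := tone 0 (- al) al s.
have DC s : is_derive s 1 C (S s).
  have := is_derive_tone 1 0 al s; rewrite mulr0 mulr1; exact.
(* [r] is [C ^+ 2] times the derivative of [f / C]. As [C] solves the equation of the fast tone, the
   derivative of [r] is the second derivative of [f] plus [al ^+ 2 * f], times [C]. *)
pose r s := f' s * C s - f s * S s.
have Cpos s : x1 <= s <= x4 -> 0 < C s by move=> sx; rewrite CE; apply: cpos; lra.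
have rzero x y : x1 <= x -> x < y -> y <= x4 -> f x = 0 -> f y = 0 ->
    exists2 z, x < z < y & r z = 0.
  move=> xx xy yx fx fy.
  have [||z zxy Dz] := @Rolle_derive (fun s => f s * (C s)^-1)
      (fun s => f s *: (- (C s) ^- 2 *: S s) + (C s)^-1 *: f' s) x y xy.
  - move=> s sxy; apply: (is_deriveM (Df s)).
    by apply: is_deriveV => //; rewrite gt_eqF// Cpos//; lra.
  - by rewrite fx fy !mul0r.
  exists z => //.
  have Cz : C z != 0 by rewrite gt_eqF// Cpos//; lra.
  apply: (mulIf (expf_neq0 2 (invr_neq0 Cz))); rewrite mul0r -[RHS]Dz.
  by rewrite /r /GRing.scale/=; field.
have [z1 z1x r1] := rzero x1 x2 (lexx _) x12 ltac:(lra) f1 f2.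
have [z2 z2x r2] := rzero x2 x3 ltac:(lra) x23 ltac:(lra) f2 f3.
have [z3 z3x r3] := rzero x3 x4 ltac:(lra) x34 (lexx _) f3 f4.
have Dr s : is_derive s 1 r ((al ^+ 2 - om ^+ 2) * tone c d om s * C s).
  have Df' : is_derive s 1 f' (tone (al * - (al * a)) (- (al * (al * b))) al s +
      tone (om * - (om * c)) (- (om * (om * d))) om s).
    exact: (is_deriveD (is_derive_tone _ _ al s) (is_derive_tone _ _ om s)).
  have DS : is_derive s 1 S (tone (al * - al) (- (al * 0)) al s).
    exact: is_derive_tone.
  apply: (is_derive_eq (is_deriveB (is_deriveM Df' (DC s)) (is_deriveM (Df s) DS))).
  by rewrite /f /f' /C /S /tone /GRing.scale/=; ring.
have szero x y : x1 <= x -> x < y -> y <= x4 -> r x = 0 -> r y = 0 ->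
    exists2 z, x < z < y & tone c d om z = 0.
  move=> xx xy yx rx ry.
  have [|z zxy Dz] := @Rolle_derive r _ x y xy (fun s _ => Dr s); first by rewrite rx ry.
  exists z => //; move: Dz => /eqP; rewrite !mulf_eq0 subr_sqr mulf_eq0.
  have -> : (C z == 0) = false by rewrite gt_eqF// Cpos//; lra.
  have -> : (al - om == 0) = false by rewrite gt_eqF// subr_gt0.
  have -> : (al + om == 0) = false by rewrite gt_eqF// addr_gt0.
  by rewrite orbF => /eqP.
have [y1 y1z s1] := szero z1 z2 ltac:(lra) ltac:(lra) ltac:(lra) r1 r2.
have [y2 y2z s2] := szero z2 z3 ltac:(lra) ltac:(lra) ltac:(lra) r2 r3.
have allt x y : 0 <= x -> x < y -> y <= l -> al * (y - x) < pi.
  move=> x0 xy yl.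
  have : al * (y - x) <= al * l by rewrite ler_pM2l//; lra.
  by have := pi_gt0 R; lra.
have [c0 d0] : c = 0 /\ d = 0.
  apply: (@tone_two_zeros c d om y1 y2) => //; first lra.
  apply: le_lt_trans (allt y1 y2 _ _ _); try lra.
  by rewrite ler_wpM2r//; lra.
have slow0 s : tone c d om s = 0 by rewrite /tone c0 d0 !mul0r addr0.
apply: (@tone_two_zeros a b al x1 x2) => //.
- by apply: allt; lra.
- by move: f1; rewrite /f slow0 addr0.
- by move: f2; rewrite /f slow0 addr0.
Qed.

End Zeros.

Section LocalMaxEvent.
Context (d : measure_display) (T : measurableType d) (R : realType).
Variable X : R -> T -> R.
Hypotheses (cX : continuous_paths X) (mX : forall t, measurable_fun setT (X t)).

Lemma local_max_inP a b w : local_max_in X a b w <->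
  exists u e, [/\ 0 < e, a < u < b & forall s, `|s - u| < e -> X s w <= X u w].
Proof.
split=> [[u uab [/= e e0 He]]|[u [e [e0 uab He]]]].
  by exists u, e; split=> // s su; apply: He; rewrite /= distrC.
by exists u => //; exists e => //= s su; apply: He; rewrite distrC.
Qed.

(** A local maximum exists exactly when, for some rationals, the supremum over a middle segment is
    at least those over both adjacent segments: a maximiser over the middle segment is then a local
    maximum, even at an end of it. *)
Lemma measurable_local_max_in a b : measurable [set w | local_max_in X a b w].
Proof.
have uX w : usc (X^~ w) by apply: continuous_usc; exact: cX.
pose ok := [set q : (rat * rat) * (rat * rat) |
  [/\ a < ratr q.1.1, (ratr q.1.1 : R) < ratr q.1.2, (ratr q.1.2 : R) < ratr q.2.1,
      (ratr q.2.1 : R) < ratr q.2.2 & ratr q.2.2 < b]].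
pose E (q : (rat * rat) * (rat * rat)) :=
  [set w | path_sup X (ratr q.1.1) (ratr q.1.2) w <= path_sup X (ratr q.1.2) (ratr q.2.1) w] `&`
  [set w | path_sup X (ratr q.2.1) (ratr q.2.2) w <= path_sup X (ratr q.1.2) (ratr q.2.1) w].
have -> : [set w | local_max_in X a b w] = \bigcup_(q in ok) E q.
  apply/seteqP; split=> w /=.
    move=> /local_max_inP[u [e [e0 uab He]]].
    have [m1 m2] : Num.max a (u - e) < u /\ u < Num.min b (u + e).
      by rewrite gt_max lt_min; lra.
    have [q2] := rat_in_itvoo m1; rewrite in_itv/= => /andP[aq2 q2u].
    have [q1] := rat_in_itvoo aq2; rewrite in_itv/= gt_max => /andP[/andP[aq1 eq1] q1q2].
    have [r1] := rat_in_itvoo m2; rewrite in_itv/= => /andP[ur1 r1b].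
    have [r2] := rat_in_itvoo r1b; rewrite in_itv/= lt_min => /andP[r1r2 /andP[r2b r2e]].
    exists ((q1, q2), (r1, r2)); first by split => /=; lra.
    have top : X u w <= path_sup X (ratr q2) (ratr r1) w.
      by apply: (seg_sup_ub (uX w)); lra.
    split=> /=; apply: le_trans top; apply/(seg_sup_leP (uX w)); rewrite ?ltW//.
      by move=> s sq; apply: He; rewrite ltr_norml; lra.
    by move=> s sq; apply: He; rewrite ltr_norml; lra.
  move=> [[[q1 q2] [r1 r2]] [/= aq q12 q2r r12 rb] [/= E1 E2]].
  have [u uqr uE] := seg_sup_attained (uX w) (ltW q2r).
  apply/local_max_inP; exists u, (Num.min (ratr q2 - ratr q1) (ratr r2 - ratr r1)).
  split; [by rewrite lt_min !subr_gt0 q12 r12|lra|].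
  move=> s; rewrite lt_min => /andP[].
  rewrite !ltr_norml uE => s1 s2.
  have [sq|sq] := leP s (ratr q2).
    by apply: le_trans E1; apply: (seg_sup_ub (uX w)); lra.
  have [sr|sr] := leP s (ratr r1).
    by apply: (seg_sup_ub (uX w)); lra.
  by apply: le_trans E2; apply: (seg_sup_ub (uX w)); lra.
apply: bigcup_count_measurable => -[[q1 q2] [r1 r2]] [/= aq q12 q2r r12 rb].
by apply: measurableI; apply: measurable_le_set;
  apply: measurable_path_sup_continuous => //; exact: ltW.
Qed.

End LocalMaxEvent.

Section LocalMaxRate.
Context {R : realType}.
Variables al om sg : R.
Local Notation X := (two_tone al om sg).
Local Notation M a b := [set w | local_max_in X a b w].

Let mM a b : measurable (M a b).
Proof.
apply: measurable_local_max_in; first exact: two_tone_continuous.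
exact: two_tone_measurable.
Qed.

Lemma pr_local_max_shift h a b :
  pr gauss4 (M (a + h) (b + h)) = pr gauss4 (M a b).
Proof.
apply: (congr1 fine (etrans _ (gauss4_phase_shift al om h (mM a b)))).
apply: (congr1 (fun B => gauss4 B)); apply/seteqP; split=> w /= /local_max_inP[u [e [e0 uab He]]];
  apply/local_max_inP.
  exists (u - h), e; split=> //; first lra.
  move=> s su; rewrite /phase_shift -!two_tone_shift subrK; apply: He.
  by rewrite opprB addrA in su.
exists (u + h), e; split=> //; first lra.
move=> s su; have := He (s - h).
rewrite /phase_shift -!two_tone_shift subrK; apply.
by move: su; rewrite opprD addrA addrAC.
Qed.

Lemma pr_local_max_cover e e' n : 0 < e -> e' < n.+1%:R * e ->
  pr gauss4 (M 0 e') <= n.+1%:R * pr gauss4 (M 0 e).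
Proof.
(* Spacing the open windows of length [e] by [c < e] makes them overlap, so a maximum at a multiple
   of [c] is not lost. *)
move=> e0 en; pose c := e' / n.+1%:R.
have ce : c < e by rewrite ltr_pdivrMr// mulrC.
have sub : M 0 e' `<=` \big[setU/set0]_(k < n.+1) M (k%:R * c) (k%:R * c + e).
  move=> w /= /local_max_inP[u [r [r0 /andP[u0 ue] Hr]]].
  have e'0 : 0 < e' by lra.
  have c0 : 0 < c by rewrite divr_gt0.
  have [k [kn /andP[k1 k2]]] : exists k : nat, (k < n.+1)%N /\ k%:R * c < u < k%:R * c + e.
    have un : u < n.+1%:R * c by rewrite mulrC divfK.
    elim: (n.+1) un => [|m IH un]; first by rewrite mul0r; lra.
    have [uc|cu] := ltP u (m%:R * c).
      by have [k [km kP]] := IH uc; exists k; split=> //; exact: ltnW.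
    have [um|um] := eqVneq u (m%:R * c).
      case: m IH un cu um => [|m] IH un cu um; first by move: um u0; rewrite mul0r; lra.
      exists m; split; first exact: ltnW.
      by rewrite um -natr1 mulrDl mul1r; lra.
    exists m; split=> //; move: un; rewrite -natr1 mulrDl mul1r => un.
    by rewrite lt_neqAle eq_sym um cu; lra.
  rewrite -(bigcup_mkord n.+1 (fun k => M (k%:R * c) (k%:R * c + e))); exists k => //.
  by apply/local_max_inP; exists u, r; split=> //; rewrite k1.
apply: (@le_trans _ _ (pr gauss4 (\big[setU/set0]_(k < n.+1) M (k%:R * c) (k%:R * c + e)))).
  by apply: (pr_le gauss4 (mM _ _) _ sub); apply: bigsetU_measurable => k _; exact: mM.
elim: (n.+1) => [|m IH]; first by rewrite big_ord0 mul0r /pr measure0.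
rewrite big_ord_recr/= -natr1 mulrDl mul1r.
have mU : measurable (\big[setU/set0]_(k < m) M (k%:R * c) (k%:R * c + e)).
  by apply: bigsetU_measurable => k _; exact: mM.
apply: (le_trans (prU_le gauss4 mU (mM _ _))); apply: (lerD IH).
have := pr_local_max_shift (m%:R * c) 0 e.
by rewrite add0r [e + _]addrC => ->.
Qed.

Hypotheses (om0 : 0 < om) (omal : om < al).

Lemma is_derive_two_tone w (s : R) : is_derive s 1 (X^~ w : R -> R)
  (tone (al * w.1.2) (- (al * w.1.1)) al s +
   tone (om * (sg * w.2.1)) (- (om * (sg * w.2.2))) om s).
Proof.
have -> : X^~ w = fun s : R => tone w.1.1 w.1.2 al s + tone (sg * w.2.2) (sg * w.2.1) om s.
  by apply/funext => x; rewrite /two_tone /tone; ring.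
exact: (is_deriveD (is_derive_tone _ _ al s) (is_derive_tone _ _ om s)).
Qed.

Lemma local_max_derive0 a b w : local_max_in X a b w -> exists2 u, a < u < b &
  tone (al * w.1.2) (- (al * w.1.1)) al u +
  tone (om * (sg * w.2.1)) (- (om * (sg * w.2.2))) om u = 0.
Proof.
move=> /local_max_inP[u [e [e0 uab He]]]; exists u => //.
have D0 : is_derive u 1 (X^~ w : R -> R) 0.
  apply: (@derive1_at_max R _ (u - e) (u + e)); first lra.
  - by move=> t _; case: (is_derive_two_tone w t).
  - by rewrite in_itv/=; lra.
  - by move=> t; rewrite in_itv/= => tu; apply: He; rewrite ltr_norml; lra.
have [_ <-] := is_derive_two_tone w u.
by have [_ ->] := D0.
Qed.

(** A maximum is a zero of the derivative, again a sum of two tones. Four zeros in disjoint cells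
    would annihilate the fast part, whose sine coefficient is [- (al * w.1.1)]. *)
Lemma local_max_count w l n : w.1.1 != 0 -> 0 < l -> al * l < pi / 2 ->
  (\sum_(k < n.+1) (w \in M (k%:R * (l / n.+1%:R))%R
                            (k%:R * (l / n.+1%:R) + l / n.+1%:R)%R) <= 3)%N.
Proof.
move=> w0 l0 all; set c := l / n.+1%:R.
have c0 : 0 < c by rewrite divr_gt0.
pose b k := (k < n.+1)%N && (w \in M (k%:R * c) (k%:R * c + c)).
rewrite (eq_bigr (fun k : 'I_n.+1 => b k : nat)); last by move=> k _; rewrite /b ltn_ord.
apply: at_most_three => i j k m ij jk km.
have step (p q : nat) : (p < q)%N -> p%:R * c + c <= q%:R * c.
  by move=> pq; rewrite -{2}[c]mul1r -mulrDl ler_wpM2r ?(ltW c0)// natr1 ler_nat.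
have sij := step _ _ ij; have sjk := step _ _ jk; have skm := step _ _ km.
have i0 : 0 <= i%:R * c by rewrite mulr_ge0// ltW.
move=> /andP[_ /set_mem/local_max_derive0[x1 x1i z1]].
move=> /andP[_ /set_mem/local_max_derive0[x2 x2j z2]].
move=> /andP[_ /set_mem/local_max_derive0[x3 x3k z3]].
move=> /andP[mn /set_mem/local_max_derive0[x4 x4m z4]].
have ml : m%:R * c + c <= l.
  have -> : l = n.+1%:R * c by rewrite mulrC divfK.
  exact: step.
have [x10 x12 x23 x34 x4l] : [/\ 0 <= x1, x1 < x2, x2 < x3, x3 < x4 & x4 <= l].
  by move: i0 sij sjk skm x1i x2j x3k x4m ml; clear; split; lra.
have [_ /eqP] : al * w.1.2 = 0 /\ - (al * w.1.1) = 0.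
  by apply: (@two_tones_four_zeros R (al * w.1.2) (- (al * w.1.1))
    (om * (sg * w.2.1)) (- (om * (sg * w.2.2))) al om l x1 x2 x3 x4).
rewrite oppr_eq0 mulf_eq0 (negbTE w0) orbF => /eqP.
by move=> al0; move: om0 omal; rewrite al0 => /lt_trans/[apply]; rewrite ltxx.
Qed.

(** Almost surely at most 3 of the [n.+1] equal cells of [[0, l]] contain a maximum. The factor 6 is
    3 times the loss, at most 2, in rounding [l / e] down to [n.+1]. *)
Lemma pr_local_max_le l e : 0 < l -> al * l < pi / 2 -> 0 < e -> e < l ->
  pr gauss4 (M 0 e) <= 6 / l * e.
Proof.
move=> l0 all e0 el.
pose n := (Num.truncn (l / e)).-1.
have /andP[t1 t2] : (Num.truncn (l / e))%:R <= l / e < (Num.truncn (l / e)).+1%:R.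
  by rewrite truncn_itv// divr_ge0// ltW.
have nE : Num.truncn (l / e) = n.+1.
  rewrite /n prednK//; apply: contraTT t2; rewrite lt0n negbK => /eqP ->.
  by rewrite -leNgt ler_pdivlMr// mul1r ltW.
rewrite nE in t1 t2.
pose c := l / n.+1%:R.
have c0 : 0 < c by rewrite divr_gt0.
have ec : e <= c by rewrite ler_pdivlMr// mulrC -ler_pdivlMr.
have sub : M 0 e `<=` M 0 c.
  move=> w /= /local_max_inP[u [r [r0 ue Hr]]]; apply/local_max_inP.
  by exists u, r; split=> //; lra.
apply: (le_trans (pr_le gauss4 (mM _ _) (mM _ _) sub)).
have pc : pr gauss4 (M 0 c) * n.+1%:R <= 3.
  pose Z := [set w : ((measurableTypeR R * measurableTypeR R) *
    (measurableTypeR R * measurableTypeR R))%type | w.1.1 != 0].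
  have mZ : measurable Z := measurable_first_coord_neq0.
  pose A k := M (k%:R * c) (k%:R * c + c) `&` Z.
  have mA k : measurable (A k) by exact: measurableI.
  have prA k : pr gauss4 (M 0 c) <= pr gauss4 (A k).
    have := pr_local_max_shift (k%:R * c) 0 c; rewrite add0r [c + _]addrC => <-.
    exact: pr_first_coord_neq0.
  have := @sum_pr_le _ _ _ gauss4 n.+1 A (fun=> set0) 3 mA (fun=> measurable0).
  have count w : \sum_(k < n.+1) (\1_(A k) w + \1_set0 w) <= 3 :> R.
    under eq_bigr do rewrite [X in _ + X]indicE in_set0 addr0.
    have [w0|w0] := eqVneq w.1.1 0.
      rewrite big1// => k _; rewrite indicE memNset// => -[_].
      by rewrite /Z /= w0 eqxx.
    apply: (@le_trans _ _ (\sum_(k < n.+1) (w \in M (k%:R * c) (k%:R * c + c))%:R)).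
      apply: ler_sum => k _; rewrite indicE ler_nat.
      by case: (boolP (w \in A k)) => // /set_mem[Mw _]; rewrite mem_set.
    by rewrite -natr_sum ler_nat; exact: local_max_count.
  move=> /(_ count) le3; apply: le_trans le3.
  rewrite mulr_natr -[X in _ *+ X]card_ord -sumr_const; apply: ler_sum => k _.
  by rewrite [X in _ + X](_ : _ = 0) ?addr0// /pr measure0.
have n0 : 0 < n.+1%:R :> R by [].
rewrite -(ler_pM2r n0); apply: (le_trans pc).
have : l < (n.+1%:R + 1) * e.
  by move: t2; rewrite -natr1 ltr_pdivrMr//.
have : 1 * e <= n.+1%:R * e by rewrite ler_wpM2r ?(ltW e0)// ler1n.
rewrite mul1r mulrDl mul1r => h1 h2.
have -> : 6 / l * e * n.+1%:R = 6 * (n.+1%:R * e) / l by field; rewrite gt_eqF.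
rewrite ler_pdivlMr//; lra.
Qed.

Lemma two_tone_local_max_rate : finite_local_max_rate gauss4 X.
Proof.
pose l : R := pi / 2 / al / 2.
have al0 : 0 < al by exact: lt_trans omal.
have pi0 := pi_gt0 R.
have l0 : 0 < l by rewrite !divr_gt0.
have all : al * l < pi / 2.
  have -> : al * l = pi / 2 / 2 by rewrite /l; field; rewrite gt_eqF.
  lra.
have [L HL] := @subadditive_rate_limit R (fun e => pr gauss4 (M 0 e)) (6 / l) l l0
  (fun e _ => pr_ge0 _ _) (fun e e0 el => pr_local_max_le l0 all e0 el)
  (fun e e' n e0 en => pr_local_max_cover e0 en).
exists L.
have -> : (fun e => (e^-1)%:E * gauss4 (M 0 e))%E =
    EFin \o (fun e => e^-1 * pr gauss4 (M 0 e)).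
  by apply/funext => e /=; rewrite EFinM prE.
by apply: cvg_EFin; [exact: nearW|exact: HL].
Qed.

End LocalMaxRate.

Section Liminf.
Context (d : measure_display) (T : measurableType d) (R : realType).
Variable P : probability T R.

(** Fatou's lemma for events. It is used to fix the window and let the slow tone vanish, the number
    of steps needed depending on the path. *)
Lemma pr_liminf (E : nat -> set T) (G : set T) (c : R) :
  (forall n, measurable (E n)) -> measurable G ->
  (forall w, G w -> exists N, forall n, (N <= n)%N -> E n w) ->
  c < pr P G -> exists N, forall n, (N <= n)%N -> c < pr P (E n).
Proof.
move=> mE mG GE cG.
pose A N := \bigcap_(n in [set n | (N <= n)%N]) E n.
have mA N : measurable (A N) by apply: bigcap_measurable => //; exists N => /=.
have mUA : measurable (\bigcup_N A N) by exact: bigcupT_measurable.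
have ndA : nondecreasing_seq A.
  move=> m n mn; apply/subsetPset => w Aw k /= nk; apply: Aw => /=.
  exact: leq_trans nk.
have cvA := @nondecreasing_cvg_mu _ _ _ P A mA mUA ndA.
have cU : c < pr P (\bigcup_N A N).
  apply: lt_le_trans cG _; apply: pr_le => //.
  by move=> w /GE[N HN]; exists N => // n /HN.
have cvA' : P (A n) @[n --> \oo] --> (pr P (\bigcup_N A N))%:E by rewrite -prE.
have [N _ HN] := cvgr_gt _ (fine_cvg cvA') _ cU.
exists N => n Nn; apply: lt_le_trans (HN n Nn) _ => /=.
by apply: pr_le => // w; apply => /=.
Qed.

End Liminf.

(** * Peaks of the fast tone and the influence of the slow one *)

Section TonePeak.
Context {R : realType}.
Implicit Types (A B al s u x p : R).

Lemma tone_expand A B al s u : tone A B al s =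
  tone A B al u * cos (al * (s - u)) + tone B (- A) al u * sin (al * (s - u)).
Proof.
rewrite {1}/tone -{1 2}(subrK u s) mulrDr cosD sinD /tone; ring.
Qed.

Lemma tone_periodic A B al p s : al * p = pi *+ 2 ->
  tone A B al (s + p) = tone A B al s.
Proof. by move=> alp; rewrite /tone mulrDr alp cosD2pi sinD2pi. Qed.

(** Periodicity makes [u] a maximum also on an open interval around it, so the derivative, which is
    the sine coefficient relative to [u], vanishes. *)
Lemma tone_at_max A B al p x u : 0 < al -> 0 < p -> al * p = pi *+ 2 ->
  x <= u <= x + p -> (forall s, x <= s <= x + p -> tone A B al s <= tone A B al u) ->
  forall s, tone A B al s = tone A B al u * cos (al * (s - u)).
Proof.
move=> al0 p0 alp xu umax s.
have D0 : is_derive u 1 (tone A B al) 0.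
  apply: (@derive1_at_max R _ (x - p) (x + p + p)); first lra.
  - by move=> t _; case: (is_derive_tone A B al t).
  - by rewrite in_itv/=; lra.
  - move=> t; rewrite in_itv/= => txp.
    have [tx|xt] := ltP t x.
      by rewrite -(tone_periodic A B t alp); apply: umax; lra.
    have [tp|pt] := leP t (x + p); first by apply: umax; lra.
    by rewrite -[t](subrK p) tone_periodic//; apply: umax; lra.
have E : al * tone B (- A) al u = 0.
  have [_ E1] := is_derive_tone A B al u; have [_ E0] := D0.
  by move: E1; rewrite E0 /tone => /esym <-; ring.
rewrite (tone_expand A B al s u); move/eqP: E.
by rewrite mulf_eq0 gt_eqF//= => /eqP ->; rewrite mul0r addr0.
Qed.

Lemma tone_max_ge0 A B al p u : al * p = pi *+ 2 ->
  (forall s, tone A B al s = tone A B al u * cos (al * (s - u))) ->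
  tone A B al (u + p / 2) <= tone A B al u -> 0 <= tone A B al u.
Proof.
move=> alp E; rewrite (E (u + p / 2)) [u + _]addrC addrK.
have -> : al * (p / 2) = pi by rewrite mulrA alp mulr2n; lra.
by rewrite cospi; lra.
Qed.

Lemma cos_gap al m z p : 0 < al -> al * p = pi *+ 2 -> 0 < m -> 2 * m <= p ->
  m <= z -> z <= p - m -> cos (al * z) <= cos (al * m).
Proof.
move=> al0 alp m0 mp mz zp.
have pi0 := pi_gt0 R.
have am0 : 0 < al * m by rewrite mulr_gt0.
have amz : al * m <= al * z by rewrite ler_pM2l.
have azp : al * z <= pi *+ 2 - al * m by rewrite -alp -mulrBr ler_pM2l.
have ampi : al * m <= pi.
  have : al * (2 * m) <= al * p by rewrite ler_pM2l.
  by rewrite alp mulrCA; lra.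
have mono y : al * m <= y -> y <= pi -> cos y <= cos (al * m).
  move=> y1 y2; rewrite leNgt ltr_cos; [|by rewrite in_itv/=; lra..].
  by rewrite -leNgt.
have [zpi|piz] := leP (al * z) pi; first exact: mono.
have -> : cos (al * z) = cos (pi *+ 2 - al * z).
  by rewrite addrC cosD2pi cosN.
by apply: mono; lra.
Qed.

End TonePeak.

Section FastTone.
Context {R : realType}.
Local Notation U := (measurableTypeR R).
Local Notation Om := ((U * U) * (U * U))%type.
Variables (al p kap e' : R).
Hypotheses (al0 : 0 < al) (p0 : 0 < p) (alp : al * p = pi *+ 2).
Hypotheses (kap0 : 0 < kap) (e'0 : 0 < e').

Local Notation F := (two_tone al 1 0).

Lemma two_tone_fast s (w : Om) : F s w = tone w.1.1 w.1.2 al s.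
Proof. by rewrite /two_tone /tone mul0r addr0. Qed.

(** The fast tone peaks during the first [e'] of the period that starts at [kap]. The offset [kap]
    keeps this peak away from the left end of the window [[0, e]]. It depends on [w.1] only. *)
Definition peak_early : set Om :=
  [set w | path_sup F kap (kap + p) w <= path_sup F kap (kap + e') w].

Let uF w : usc (F^~ w).
Proof. by apply: continuous_usc; exact: two_tone_continuous. Qed.

Lemma measurable_peak_early : measurable peak_early.
Proof.
by apply: measurable_le_set; apply: measurable_path_sup_two_tone; rewrite lerDl ltW.
Qed.

(** The shifts of the event by multiples of [e'] have equal probability and cover the space, since
    some peak falls in each period. *)
Lemma pr_peak_early n : n.+1%:R * e' = p -> 1 <= n.+1%:R * pr gauss4 peak_early.
Proof.
have [p_gt0 kap_gt0 e'_gt0] := And3 p0 kap0 e'0.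
move=> ne.
pose C k := phase_shift al 1 (k%:R * e') @^-1` peak_early.
have mps h : measurable_fun setT (@phase_shift R al 1 h) by exact: measurable_rot2.
have mC k : measurable (C k).
  rewrite -[S in measurable S]setTI; apply: mps => //; exact: measurable_peak_early.
have prC k : pr gauss4 (C k) = pr gauss4 peak_early.
  exact: (congr1 fine (gauss4_phase_shift al 1 (k%:R * e') measurable_peak_early)).
have cover : setT `<=` \big[setU/set0]_(k < n.+1) C k.
  move=> w _.
  have [u uk uE] : exists2 u, kap <= u <= kap + p &
      forall s, kap <= s <= kap + p -> F s w <= F u w.
    by apply: usc_max => //; lra.
  have umax s : kap <= s <= kap + p -> tone w.1.1 w.1.2 al s <= tone w.1.1 w.1.2 al u.
    by move=> sk; rewrite -!two_tone_fast; exact: uE.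
  have E := tone_at_max al0 p0 alp uk umax.
  have half : tone w.1.1 w.1.2 al (u + p / 2) <= tone w.1.1 w.1.2 al u.
    have [up|up] := leP (u + p / 2) (kap + p); first by apply: umax; lra.
    rewrite -[u + p / 2](subrK p) tone_periodic//.
    by apply: umax; lra.
  have rho0 := tone_max_ge0 alp E half.
  have glob s : F s w <= F u w.
    by rewrite !two_tone_fast E ler_piMr// cos_le1.
  have [k [kn k1 k2]] : exists k : nat, [/\ (k < n.+1)%N,
      kap + k%:R * e' <= u & u <= kap + k%:R * e' + e'].
    have un : u <= kap + n.+1%:R * e' by rewrite ne; lra.
    elim: (n) un => [|m IH un].
      by rewrite mul1r => un; exists 0; rewrite mul0r addr0; split=> //; lra.
    have [uc|cu] := leP u (kap + m.+1%:R * e').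
      by have [k [km k1 k2]] := IH uc; exists k; split=> //; exact: ltnW.
    exists m.+1; split=> //; first exact: ltW.
    by move: un; rewrite -[m.+2%:R]natr1 mulrDl mul1r addrA.
  rewrite -(bigcup_mkord n.+1 C); exists k => //.
  rewrite /C /peak_early /= -!path_sup_phase_shift.
  apply: (@le_trans _ _ (F u w)).
    have kk : kap + k%:R * e' <= kap + p + k%:R * e' by lra.
    by apply/(seg_sup_leP (@uF w) _ kk) => s _; exact: glob.
  by apply: (seg_sup_ub (@uF w)); lra.
have : 1 <= pr gauss4 (\big[setU/set0]_(k < n.+1) C k).
  rewrite -(@pr_setT _ _ _ gauss4); apply: (pr_le gauss4 _ _ cover) => //.
  by apply: bigsetU_measurable => k _; exact: mC.
move=> h; apply: (le_trans h).
elim: (n.+1) => [|m IH]; first by rewrite big_ord0 mul0r /pr measure0.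
rewrite big_ord_recr/= -natr1 mulrDl mul1r.
have mU : measurable (\big[setU/set0]_(k < m) C k).
  by apply: bigsetU_measurable => k _; exact: mC.
have prCle : pr gauss4 (C m) <= pr gauss4 peak_early :=
  eq_ind_r (fun x => x <= pr gauss4 peak_early) (lexx _) (prC m).
exact: le_trans (prU_le gauss4 mU (mC m)) (lerD IH prCle).
Qed.

Definition slow_sign (th : R) : set Om := [set w | 0 < th * w.2.1].

Lemma measurable_slow_sign th : measurable (slow_sign th).
Proof.
apply: measurable_lt_set => //.
have := @measurable_lin4 R 0 0 th 0.
apply: eq_measurable_fun => w _.
by rewrite !mul0r add0r add0r addr0.
Qed.

(** A half turn of the slow pair flips the sign of [w.2.1] and leaves the fast tone unchanged, so
    both signs are equally likely given an early peak. *)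
Lemma pr_peak_early_sign th : th != 0 ->
  pr gauss4 peak_early <= 2 * pr gauss4 (peak_early `&` slow_sign th).
Proof.
move=> th0.
have mPS t : measurable (peak_early `&` slow_sign t).
  by apply: measurableI; [exact: measurable_peak_early|exact: measurable_slow_sign].
pose Z : set Om := [set w | 0 * w.1.1 + 0 * w.1.2 + (1 * w.2.1 + 0 * w.2.2) = 0].
have mZ : measurable Z := measurable_lin4_eq0 0 0 1 0.
have nz : 0 ^+ 2 + 0 ^+ 2 + (1 ^+ 2 + 0 ^+ 2) != 0 :> R.
  by rewrite !expr2 !mul0r !add0r mul1r addr0 oner_eq0.
have Z0 : pr gauss4 Z = 0 := congr1 fine (gauss4_lin_eq0 nz).
have opp : pr gauss4 (peak_early `&` slow_sign (- th)) =
    pr gauss4 (peak_early `&` slow_sign th).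
  have c1 : 1 ^+ 2 + 0 ^+ 2 = 1 :> R by rewrite expr1n expr0n addr0.
  have c2 : (-1) ^+ 2 + 0 ^+ 2 = 1 :> R by rewrite sqrrN expr1n expr0n addr0.
  apply: (congr1 fine (etrans _ (gauss4_rot2 c1 c2 (mPS th)))).
  apply: (congr1 (fun B => gauss4 B)).
  have rE w : rot2 1 0 (-1) 0 w = (w.1, (- w.2.1, - w.2.2)) :> Om.
    by rewrite /rot2 /planerot !mul0r !mul1r !mulN1r !subr0 !add0r; case: w => -[].
  have SE w a b : path_sup F a b (w.1, (- w.2.1, - w.2.2)) = path_sup F a b w.
    apply: (congr1 (fun f => seg_sup f a b)); apply/funext => s.
    by rewrite !two_tone_fast.
  by apply/seteqP; split=> w /=; rewrite rE /peak_early /slow_sign /= !SE mulNr mulrN.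
have sub : peak_early `<=`
    (peak_early `&` slow_sign th) `|` (peak_early `&` slow_sign (- th)) `|` Z.
  move=> w Pw; have [w0|w0|w0] := ltgtP (th * w.2.1) 0.
  - have w1 : 0 < - th * w.2.1 by rewrite mulNr oppr_gt0.
    exact: (or_introl (or_intror (conj Pw w1))).
  - exact: (or_introl (or_introl (conj Pw w0))).
  - have w1 : w.2.1 = 0 by apply/eqP; move/eqP: w0; rewrite mulf_eq0 (negbTE th0).
    have w2 : 0 * w.1.1 + 0 * w.1.2 + (1 * w.2.1 + 0 * w.2.2) = 0.
      by rewrite w1 !mul0r mulr0 !addr0.
    exact: (or_intror w2).
have mU : measurable ((peak_early `&` slow_sign th) `|` (peak_early `&` slow_sign (- th))).
  exact: measurableU.
apply: (le_trans (pr_le gauss4 measurable_peak_early (measurableU _ _ mU mZ) sub)).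
have Z0l : pr gauss4 Z <= 0 := eq_ind_r (fun x => x <= 0) (lexx _) Z0.
apply: (le_trans (prU_le gauss4 mU mZ)); apply: (le_trans (lerD (lexx _) Z0l)).
apply: (eq_ind_r (fun x => x <= _) _ (addr0 _)).
apply: (le_trans (prU_le gauss4 (mPS th) (mPS (- th)))).
have oppl : pr gauss4 (peak_early `&` slow_sign (- th)) <=
    pr gauss4 (peak_early `&` slow_sign th) :=
  eq_ind_r (fun x => x <= _) (lexx _) opp.
apply: (le_trans (lerD (lexx _) oppl)).
by move: (pr gauss4 _) => x; rewrite mulr2n mulrDl mul1r.
Qed.

End FastTone.

Section SlowTone.
Context {R : realType}.
Implicit Types (c d al om s z p th W : R).

Lemma tone_norm_le c d om s : `|tone c d om s| <= `|c| + `|d|.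
Proof.
apply: (le_trans (ler_normD _ _)); rewrite !normrM.
apply: lerD; rewrite ler_piMr//.
  by rewrite ler_norml cos_geN1 cos_le1.
by rewrite ler_norml sin_geN1 sin_le1.
Qed.

Lemma tone_increment c d om s p : tone c d om s - tone c d om (s - p) =
  2 * sin (om * (p / 2)) * tone d (- c) om (s - p / 2).
Proof.
have E1 : om * s = om * (s - p / 2) + om * (p / 2) by rewrite -mulrDr subrK.
have E2 : om * (s - p) = om * (s - p / 2) - om * (p / 2).
  by rewrite -mulrBr; congr (_ * _); lra.
by rewrite /tone E1 E2 !cosD !sinD cosN sinN; ring.
Qed.

(** The tone depends on [om] and [s] only through their product, so one neighbourhood of 0 serves
    all frequencies. *)
Lemma tone_sign_near0 c d th : 0 < th * d -> exists2 dl, 0 < dl &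
  forall om s, `|om * s| < dl -> 0 < th * tone d c om s.
Proof.
move=> thd.
have cont : continuous (tone d c 1).
  move=> z; apply/differentiable_continuous/derivable1_diffP.
  by case: (is_derive_tone d c 1 z).
have c0 : th * tone d c 1 z @[z --> 0] --> th * tone d c 1 0.
  by apply: cvgM; [exact: cvg_cst|exact: cont].
have t0 : 0 < th * tone d c 1 0.
  by rewrite /tone mulr0 cos0 sin0 mulr1 mulr0 addr0.
have [/= dl dl0 H] := cvgr_gt _ c0 _ t0.
exists dl => // om s oms.
have := H (om * s); rewrite /= sub0r normrN => /(_ oms).
by rewrite /tone !mul1r.
Qed.

Lemma slow_tone_monotone c d th p W : 0 < p -> 0 < th * d ->
  \forall n \near \oo, forall s, `|s| <= W ->
    0 < th * (tone c d n.+1%:R^-1 s - tone c d n.+1%:R^-1 (s - p)).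
Proof.
move=> p0 thd; have [dl dl0 H] := tone_sign_near0 (- c) thd.
have W1 : 0 < `|W| + p + 1 by have := normr_ge0 W; lra.
have e0 : 0 < Num.min (dl / (`|W| + p + 1)) (pi / p).
  by rewrite lt_min !divr_gt0// pi_gt0.
near=> n.
have : n.+1%:R^-1 < Num.min (dl / (`|W| + p + 1)) (pi / p).
  by near: n; exact: (near_infty_natSinv_lt (PosNum e0)).
set om := n.+1%:R^-1 => oml s sW.
have om0 : 0 < om by rewrite invr_gt0.
move: oml; rewrite lt_min !ltr_pdivlMr// => /andP[om1 om2].
rewrite tone_increment mulrCA mulr_gt0//; last first.
  apply: H; rewrite normrM gtr0_norm//; apply: le_lt_trans om1.
  rewrite ler_pM2l//; apply: (le_trans (ler_normB _ _)).
  have := ler_norm W; have p2 : 0 <= p / 2 by lra.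
  by rewrite (ger0_norm p2); lra.
rewrite mulr_gt0//; apply: sin_gt0_pi.
have op : 0 < om * p by rewrite mulr_gt0.
by apply/andP; split; rewrite mulrA ?divr_gt0//; have := pi_gt0 R; lra.
Unshelve. all: by end_near.
Qed.

End SlowTone.

Section PeakPersists.
Context {R : realType}.
Local Notation U := (measurableTypeR R).
Local Notation Om := ((U * U) * (U * U))%type.
Variables (al p kap e' e : R).
Hypotheses (al0 : 0 < al) (p0 : 0 < p) (alp : al * p = pi *+ 2).
Hypotheses (kap0 : 0 < kap) (e'0 : 0 < e') (kape : kap + e' < e) (ep : e < p).
Variable w : Om.
Hypotheses (early : peak_early al p kap e' w) (w0 : w.1.1 != 0).

Local Notation X n := (two_tone al n.+1%:R^-1 n.+1%:R^-1).

Lemma two_tone_split (n : nat) s : X n s w = tone w.1.1 w.1.2 al s +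
  n.+1%:R^-1 * tone w.2.2 w.2.1 n.+1%:R^-1 s.
Proof. by rewrite /two_tone /tone; congr (_ + _ * _); exact: addrC. Qed.

Lemma peak_gap : exists u eta, [/\ 0 < eta, kap <= u <= kap + e' &
  forall s, e - p <= s <= 0 \/ e <= s <= p ->
    tone w.1.1 w.1.2 al s <= tone w.1.1 w.1.2 al u - eta].
Proof.
have [p_gt0 kap_gt0 e'_gt0] := And3 p0 kap0 e'0.
have [kape_lt ep_lt _] := And3 kape ep p0.
have uF : usc (two_tone al 1 0 ^~ w).
  by apply: continuous_usc; exact: two_tone_continuous.
have kk : kap <= kap + e' by lra.
have [u uk uE] := seg_sup_attained uF kk.
have umax s : kap <= s <= kap + p -> tone w.1.1 w.1.2 al s <= tone w.1.1 w.1.2 al u.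
  move=> sk; rewrite -!two_tone_fast;
  apply: (@le_trans _ _ (path_sup (two_tone al 1 0) kap (kap + p) w)).
    exact: (seg_sup_ub uF).
  by apply: (le_trans early); rewrite uE.
have ukp : kap <= u <= kap + p by lra.
have E := tone_at_max al0 p0 alp ukp umax.
have half : tone w.1.1 w.1.2 al (u + p / 2) <= tone w.1.1 w.1.2 al u.
  have [up|up] := leP (u + p / 2) (kap + p); first by apply: umax; lra.
  rewrite -[u + p / 2](subrK p) tone_periodic//.
  by apply: umax; lra.
have rho0 : 0 < tone w.1.1 w.1.2 al u.
  rewrite lt_neqAle (tone_max_ge0 alp E half) andbT eq_sym; apply/eqP => r0.
  move/eqP: w0; apply; have := E 0; rewrite r0 mul0r.
  by rewrite /tone !mulr0 cos0 sin0 mulr1 mulr0 addr0.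
(* Every point [s] of the two ranges has distance at least [m] from all translates of [u] by
   multiples of [p]. *)
pose m := Num.min kap (e - kap - e').
have m0 : 0 < m by rewrite lt_min; lra.
have [mk me] : m <= kap /\ m <= e - kap - e' by rewrite !ge_min !lexx orbT.
have c1 : cos (al * m) < 1.
  have pi0 := pi_gt0 R.
  have amp : al * m < pi.
    have : al * (m + m) < al * p by rewrite ltr_pM2l//; lra.
    by rewrite alp mulrDr mulr2n; lra.
  have am0 : 0 < al * m by rewrite mulr_gt0.
  by rewrite -[Y in _ < Y]cos0 ltr_cos// in_itv/= ?lexx; lra.
exists u, (tone w.1.1 w.1.2 al u * (1 - cos (al * m))).
split=> //; first by rewrite mulr_gt0// subr_gt0.
move=> s sP; rewrite (E s); set A := tone _ _ _ u.
have -> : A - A * (1 - cos (al * m)) = A * cos (al * m) by ring.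
rewrite ler_pM2l//.
have mp : 2 * m <= p by lra.
case: sP => sP; last by apply: (cos_gap al0 alp m0 mp); lra.
rewrite -cosN -mulrN opprB; apply: (cos_gap al0 alp m0 mp); lra.
Qed.

Lemma peak_gap_near : exists2 u, 0 <= u <= e & \forall n \near \oo,
  forall s, e - p <= s <= 0 \/ e <= s <= p -> X n s w < X n u w.
Proof.
have [p_gt0 kap_gt0 e'_gt0] := And3 p0 kap0 e'0.
have [kape_lt ep_lt _] := And3 kape ep p0.
have [u [eta [eta0 uk gap]]] := peak_gap.
exists u; first lra.
pose K := `|w.2.2| + `|w.2.1|.
have K0 : 0 <= K by rewrite addr_ge0.
(* [K] bounds the slow tone, so its contribution to a difference is at most [2 * K] times its
   amplitude; the added 1 keeps the divisor positive. *)
have K1 : 0 < 2 * K + 1 by lra.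
have e1 : 0 < eta / (2 * K + 1) by rewrite divr_gt0.
near=> n.
have : n.+1%:R^-1 < eta / (2 * K + 1).
  by near: n; exact: (near_infty_natSinv_lt (PosNum e1)).
move=> oml s sP; have := gap s sP; rewrite !two_tone_split.
move: oml; set om := n.+1%:R^-1.
have om0 : 0 < om by rewrite invr_gt0.
rewrite ltr_pdivlMr// mulrDr mulr1 => omK.
have := tone_norm_le w.2.2 w.2.1 om s; rewrite ler_norml -/K => /andP[_ hs].
have := tone_norm_le w.2.2 w.2.1 om u; rewrite ler_norml -/K => /andP[hu _].
have hs' : om * tone w.2.2 w.2.1 om s <= om * K by rewrite ler_pM2l.
have hu' : om * - K <= om * tone w.2.2 w.2.1 om u by rewrite ler_pM2l.
by move: hs' hu' omK; rewrite mulrN mulrCA; lra.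
Unshelve. all: by end_near.
Qed.

Variables (a b : R).
Hypotheses (a0 : 0 <= a) (b0 : 0 <= b).

Let uX (n : nat) : usc (X n ^~ w).
Proof. by apply: continuous_usc; exact: two_tone_continuous. Qed.

Lemma left_in_criterion (n : nat) :
  (forall s, - a <= s <= 0 -> X n s w < path_sup (X n) 0 e w) ->
  (forall s, e <= s <= e + b -> X n s w <= path_sup (X n) 0 e w) ->
  left_in (X n) (- a) 0 e (b + e) w.
Proof.
move=> Ha Hb; have a_ge0 : - a <= 0 by rewrite oppr_le0.
have b_ge0 : e <= b + e by rewrite lerDr.
split; first by apply/(seg_sup_ltP (@uX n) _ a_ge0) => s; exact: Ha.
by apply/(seg_sup_leP (@uX n) _ b_ge0) => s; rewrite [b + e]addrC; exact: Hb.
Qed.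

Lemma left_in_near_mid : a + e <= p -> b + e <= p ->
  \forall n \near \oo, left_in (X n) (- a) 0 e (b + e) w.
Proof.
move=> ap bp; have [u ue H] := peak_gap_near; have a_ge0 := a0; have b_ge0 := b0.
near=> n.
have Hn : forall s, e - p <= s <= 0 \/ e <= s <= p -> X n s w < X n u w by near: n.
have top : X n u w <= path_sup (X n) 0 e w by exact: (seg_sup_ub (@uX n)).
apply: left_in_criterion => s sP.
  by apply: lt_le_trans top; apply: Hn; left; lra.
by apply: le_trans top; apply/ltW/Hn; right; lra.
Unshelve. all: by end_near.
Qed.

Lemma two_tone_increment (n : nat) s : X n s w - X n (s - p) w =
  n.+1%:R^-1 * (tone w.2.2 w.2.1 n.+1%:R^-1 s - tone w.2.2 w.2.1 n.+1%:R^-1 (s - p)).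
Proof.
rewrite !two_tone_split -[in tone w.1.1 w.1.2 al s](subrK p s).
by rewrite (tone_periodic w.1.1 w.1.2 (s - p) alp); ring.
Qed.

(** Later peaks may fall within the right length. Going back one period raises the path, so each
    point after the window is brought back to [[e - p, e]], where the peak in the window wins. *)
Lemma left_in_near_decreasing : a + e <= p -> 0 < -1 * w.2.1 ->
  \forall n \near \oo, left_in (X n) (- a) 0 e (b + e) w.
Proof.
move=> ap w2; have [u ue H] := peak_gap_near; have a_ge0 := a0; have b_ge0 := b0.
have [p_gt0 ep_lt _] := And3 p0 ep p0.
have mono := slow_tone_monotone w.2.2 (e + b) p_gt0 w2.
near=> n.
have Hn : forall s, e - p <= s <= 0 \/ e <= s <= p -> X n s w < X n u w by near: n.
have top : X n u w <= path_sup (X n) 0 e w by exact: (seg_sup_ub (@uX n)).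
have dec s : `|s| <= e + b -> X n s w < X n (s - p) w.
  move=> sb; rewrite -subr_lt0 two_tone_increment pmulr_rlt0 ?invr_gt0//.
  have : forall s, `|s| <= e + b ->
    0 < -1 * (tone w.2.2 w.2.1 n.+1%:R^-1 s - tone w.2.2 w.2.1 n.+1%:R^-1 (s - p)).
    by near: n.
  by move=> /(_ s sb); rewrite mulN1r oppr_gt0.
have back (m : nat) s : e - p <= s -> s <= e + m%:R * p -> s <= e + b ->
    X n s w <= path_sup (X n) 0 e w.
  elim: m s => [|m IH] s s1 s2 s3.
    have [s0|s0] := leP s 0.
      by apply: le_trans top; apply/ltW/Hn; left; lra.
    by apply: (seg_sup_ub (@uX n)); lra.
  have [se|se] := leP s e; first by apply: IH => //; rewrite ler_wpDr// mulr_ge0// ltW.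
  have ds : X n s w < X n (s - p) w by apply: dec; rewrite ger0_norm; lra.
  apply: (le_trans (ltW ds)); apply: IH; [lra| |lra].
  by move: s2; rewrite -natr1 mulrDl mul1r; lra.
apply: left_in_criterion => s sP.
  by apply: lt_le_trans top; apply: Hn; left; lra.
apply: (back (Num.truncn (b / p)).+1); [lra| |lra].
have : b < (Num.truncn (b / p)).+1%:R * p by rewrite -ltr_pdivrMr//; exact: truncnS_gt.
lra.
Unshelve. all: by end_near.
Qed.

(** The mirror argument, moving points on the left forward by whole periods. *)
Lemma left_in_near_increasing : b + e <= p -> 0 < 1 * w.2.1 ->
  \forall n \near \oo, left_in (X n) (- a) 0 e (b + e) w.
Proof.
move=> bp w2; have [u ue H] := peak_gap_near; have a_ge0 := a0; have b_ge0 := b0.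
have [p_gt0 ep_lt _] := And3 p0 ep p0.
have mono := slow_tone_monotone w.2.2 (a + p) p_gt0 w2.
near=> n.
have Hn : forall s, e - p <= s <= 0 \/ e <= s <= p -> X n s w < X n u w by near: n.
have top : X n u w <= path_sup (X n) 0 e w by exact: (seg_sup_ub (@uX n)).
have inc s : `|s| <= a + p -> X n (s - p) w < X n s w.
  move=> sb; rewrite -subr_gt0 two_tone_increment mulr_gt0 ?invr_gt0//.
  have : forall s, `|s| <= a + p ->
    0 < 1 * (tone w.2.2 w.2.1 n.+1%:R^-1 s - tone w.2.2 w.2.1 n.+1%:R^-1 (s - p)).
    by near: n.
  by move=> /(_ s sb); rewrite mul1r.
have forth (m : nat) s : s <= p -> - (m%:R * p) <= s -> - a <= s ->
    X n s w <= path_sup (X n) 0 e w.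
  elim: m s => [|m IH] s s1 s2 s3.
    rewrite mul0r oppr0 in s2; have [se|se] := leP e s.
      by apply: le_trans top; apply/ltW/Hn; right; lra.
    by apply: (seg_sup_ub (@uX n)); lra.
  have [s0|s0] := leP 0 s.
    by apply: IH => //; apply: le_trans s0; rewrite oppr_le0 mulr_ge0// ltW.
  have ds : X n (s + p - p) w < X n (s + p) w by apply: inc; rewrite ler_norml; lra.
  rewrite addrK in ds.
  apply: (le_trans (ltW ds)); apply: IH; [lra| |lra].
  by move: s2; rewrite -natr1 mulrDl mul1r; lra.
apply: left_in_criterion => s sP.
  have [s1|s1] := leP (e - p) s.
    by apply: lt_le_trans top; apply: Hn; left; lra.
  (* The comparison on the left has to be strict, so one strict step is taken before the weak
     induction [forth]. *)
  have ds : X n (s + p - p) w < X n (s + p) w by apply: inc; rewrite ler_norml; lra.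
  rewrite addrK in ds; apply: (lt_le_trans ds).
  apply: (forth (Num.truncn (a / p)).+1); [lra| |lra].
  have : a < (Num.truncn (a / p)).+1%:R * p by rewrite -ltr_pdivrMr//; exact: truncnS_gt.
  lra.
by apply: le_trans top; apply/ltW/Hn; right; lra.
Unshelve. all: by end_near.
Qed.

End PeakPersists.

(** * Choice of parameters and sharpness *)

Section LargeDensity.
Context {R : realType}.
Local Notation U := (measurableTypeR R).
Local Notation Om := ((U * U) * (U * U))%type.
Implicit Types (a b c m e T t : R).

Lemma peak_parameters c m : 0 < m -> c * m < 1 -> exists (p e' e kap : R) (n : nat),
  [/\ 0 < p, 0 < kap, 0 < e', kap + e' < e & e < p] /\
  [/\ m + e <= p, n.+1%:R * e' = p & c * e < n.+1%:R^-1].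
Proof.
wlog c0 : c / 0 <= c => [H m0 cm|m0 cm].
  have [|c0] := leP 0 c; first by move=> c0; exact: H.
  have [|p [e' [e [kap [n [H1 [H2 H3 H4]]]]]]] := H 0 (lexx _) m0; first by rewrite mul0r.
  exists p, e', e, kap, n; split=> //; split=> //.
  have [k0 e0 ke] : [/\ 0 < kap, 0 < e' & kap + e' < e] by case: H1.
  apply: lt_trans (_ : 0 < _); last by rewrite invr_gt0.
  by rewrite nmulr_rlt0//; lra.
(* With [p = m * (1 + 2 * eta)] and [e = e' * (1 + eta)], the product [c * e * n.+1%:R] exceeds
   [c * m] by at most [5 * eta], half of the available room [1 - c * m]. The [2 * eta] in [p] makes
   room for [e <= 2 * e']. *)
pose eta : R := Num.min 1 ((1 - c * m) / 10).
have eta0 : 0 < eta by rewrite lt_min ltr01 divr_gt0//; lra.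
have [eta1 etac] : eta <= 1 /\ eta <= (1 - c * m) / 10.
  by rewrite !ge_min !lexx orbT.
have meta : 0 < m * eta by rewrite mulr_gt0.
pose p := m + 2 * (m * eta).
have p0 : 0 < p by rewrite /p; lra.
pose n := Num.truncn (p / (m * eta)).
have n0 : 0 < n.+1%:R :> R by [].
have np : p < n.+1%:R * (m * eta) by rewrite -ltr_pdivrMr//; exact: truncnS_gt.
pose e' := p / n.+1%:R.
have e'0 : 0 < e' by rewrite divr_gt0.
have ne' : n.+1%:R * e' = p by rewrite mulrC divfK// gt_eqF.
have e'm : e' < m * eta by rewrite ltr_pdivrMr// mulrC.
have e'eta : 0 < e' * eta by rewrite mulr_gt0.
have e'eta1 : e' * eta <= e' by rewrite ler_piMr// ltW.
exists p, e', (e' + e' * eta), (e' * eta / 2), n.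
split; first by split=> //; rewrite /p; lra.
split=> //; first by rewrite /p; lra.
rewrite -[_^-1]mul1r ltr_pdivlMr//.
have -> : c * (e' + e' * eta) * n.+1%:R = c * (n.+1%:R * e') * (1 + eta) by ring.
rewrite ne' /p.
have -> : c * (m + 2 * (m * eta)) * (1 + eta) = c * m + c * m * (3 * eta + 2 * (eta * eta)).
  by ring.
have cm0 : 0 <= c * m by rewrite mulr_ge0// ltW.
have ee : eta * eta <= eta by rewrite ler_piMr// ltW.
have ee0 : 0 <= eta * eta by rewrite mulr_ge0// ltW.
have : c * m * (3 * eta + 2 * (eta * eta)) <= 1 * (3 * eta + 2 * (eta * eta)).
  by rewrite ler_wpM2r// ?ltW//; lra.
lra.
Qed.

Local Notation X al n := (two_tone al n.+1%:R^-1 n.+1%:R^-1).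

Lemma left_in_pr_near al a b e c (G : set Om) : 0 <= a -> 0 <= b -> 0 <= e ->
  measurable G ->
  (forall w, G w -> w.1.1 != 0 ->
    \forall n \near \oo, left_in (X al n) (- a) 0 e (b + e) w) ->
  c < pr gauss4 G ->
  \forall n \near \oo, c < pr gauss4 (left_in (X al n) (- a) 0 e (b + e)).
Proof.
move=> a0 b0 e0 mG GL cG.
have cGN := lt_le_trans cG (pr_first_coord_neq0 mG).
have mGN := measurableI _ _ mG (@measurable_first_coord_neq0 R).
have na0 : - a <= 0 by rewrite oppr_le0.
have be : e <= b + e by rewrite lerDr.
have mE n : measurable (left_in (X al n) (- a) 0 e (b + e)) :=
  measurable_left_in (two_tone_stationary al n.+1%:R^-1 n.+1%:R^-1) na0 e0 be.
have GE w : (G `&` [set w | w.1.1 != 0]) w ->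
    exists N, forall n, (N <= n)%N -> left_in (X al n) (- a) 0 e (b + e) w.
  by case=> Gw w0; have [N _ NE] := GL w Gw w0; exists N => n Nn; exact: NE.
by have [N NE] := pr_liminf mE mGN GE cGN; exists N => // n /=; exact: NE.
Qed.

Lemma two_tone_peak_mid a b c : 0 <= a -> 0 <= b -> 0 < Num.max a b ->
  c * Num.max a b < 1 -> exists al e : R, [/\ 0 < al, 0 < e &
    \forall n \near \oo, c * e < pr gauss4 (left_in (X al n) (- a) 0 e (b + e))].
Proof.
move=> a0 b0 m0 cm.
have [p [e' [e [kap [n [[p0 kap0 e'0 kape ep] [mep ne' ce]]]]]]] := peak_parameters m0 cm.
have [am bm] : a <= Num.max a b /\ b <= Num.max a b by rewrite !le_max !lexx orbT.
have al0 : 0 < pi *+ 2 / p by rewrite divr_gt0// mulrn_wgt0// pi_gt0.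
have alp : pi *+ 2 / p * p = pi *+ 2 by rewrite divfK// gt_eqF.
exists (pi *+ 2 / p), e; split=> //; first lra.
apply: (@left_in_pr_near _ _ _ _ _ (peak_early (pi *+ 2 / p) p kap e')) => //.
- lra.
- exact: measurable_peak_early.
- by move=> w Gw w0; apply: (left_in_near_mid al0 p0 alp kap0 e'0 kape ep Gw w0) => //; lra.
have := pr_peak_early al0 p0 alp kap0 e'0 ne'.
rewrite -ler_pdivrMl// mulr1; exact: lt_le_trans.
Qed.

(** The period just exceeds the shorter side, where no other peak fits; the sign of the slow tone is
    chosen against the peaks on the longer side. This sign costs the factor 2. *)
Lemma two_tone_peak_sign a b c : 0 < a -> 0 < b ->
  2 * c * Num.min a b < 1 -> exists al e : R, [/\ 0 < al, 0 < e &
    \forall n \near \oo, c * e < pr gauss4 (left_in (X al n) (- a) 0 e (b + e))].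
Proof.
move=> a0 b0 cm.
have m0 : 0 < Num.min a b by rewrite lt_min a0.
have [p [e' [e [kap [n [[p0 kap0 e'0 kape ep] [mep ne' ce]]]]]]] := peak_parameters m0 cm.
have al0 : 0 < pi *+ 2 / p by rewrite divr_gt0// mulrn_wgt0// pi_gt0.
have alp : pi *+ 2 / p * p = pi *+ 2 by rewrite divfK// gt_eqF.
have [th th0 GL] : exists2 th : R, th != 0 & forall w : Om,
    (peak_early (pi *+ 2 / p) p kap e' `&` slow_sign th) w -> w.1.1 != 0 ->
    \forall n \near \oo, left_in (X (pi *+ 2 / p) n) (- a) 0 e (b + e) w.
  have [ab|ab] := leP a b.
    exists (-1); first by rewrite oppr_eq0 oner_eq0.
    move=> w [Gw sw] w0; rewrite min_l// in mep.
    exact: (left_in_near_decreasing al0 p0 alp kap0 e'0 kape ep Gw w0 (ltW a0) (ltW b0) mep sw).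
  exists 1; first exact: oner_neq0.
  move=> w [Gw sw] w0; rewrite (min_r (ltW ab)) in mep.
  exact: (left_in_near_increasing al0 p0 alp kap0 e'0 kape ep Gw w0 (ltW a0) (ltW b0) mep sw).
exists (pi *+ 2 / p), e; split=> //; first lra.
have mG := measurableI _ _ (measurable_peak_early (pi *+ 2 / p) kap p0 e'0)
  (measurable_slow_sign th).
have e_ge0 : 0 <= e by lra.
apply: (left_in_pr_near (ltW a0) (ltW b0) e_ge0 mG GL).
have := pr_peak_early al0 p0 alp kap0 e'0 ne'.
have := pr_peak_early_sign (pi *+ 2 / p) kap p0 e'0 th0.
move: (pr gauss4 _) (pr gauss4 _) => q r qr.
rewrite -ler_pdivrMl// mulr1 => nq.
move: ce; rewrite -mulrA => /lt_le_trans-/(_ _ (le_trans nq qr)).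
by rewrite ltr_pM2l.
Qed.

Lemma two_tone_peak T t c : 0 < t < T -> c < density_bound T t ->
  exists al e : R, [/\ 0 < al, 0 < e & \forall n \near \oo,
    c * e < pr gauss4 (left_in (X al n) (- t) 0 e (T - t + e))].
Proof.
move=> /andP[t0 tT] cB; have tT0 : 0 < T - t by lra.
have : c * Num.max t (T - t) < 1 \/ 2 * c * Num.min t (T - t) < 1.
  move: cB; rewrite /density_bound; case: ifPn => [t1|].
    rewrite -[_^-1]mul1r ltr_pdivlMr ?mulr_gt0// => cB; right.
    by rewrite min_l; lra.
  rewrite -ltNge => t1; case: ifPn => [t2|].
    rewrite -[_^-1]mul1r ltr_pdivlMr// => cB; left.
    by rewrite max_r//; lra.
  rewrite -ltNge => t2; case: ifPn => [t3|].
    rewrite -[_^-1]mul1r ltr_pdivlMr// => cB; left.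
    by rewrite max_l//; lra.
  rewrite -ltNge => t3.
  rewrite -[_^-1]mul1r ltr_pdivlMr ?mulr_gt0// => cB; right.
  by rewrite min_r; lra.
case=> cm; last exact: two_tone_peak_sign.
by apply: two_tone_peak_mid; rewrite ?ltW// lt_max t0.
Qed.

(** The conditions on [om] beyond the density estimate are those needed for uniqueness and for the
    finite rate of local maxima; they too hold for all large [n]. *)
Lemma two_tone_large_density T t c : 0 < t < T -> c < density_bound T t ->
  exists al om : R, [/\ 0 < om, om < al, om * T < pi &
    c < sup_density gauss4 (two_tone al om om) T t].
Proof.
move=> t0T cB; have [al [e [al0 e0 peak]]] := two_tone_peak t0T cB.
have T0 : 0 < T by lra.
have m0 : 0 < Num.min al (pi / T) by rewrite lt_min al0 divr_gt0// pi_gt0.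
have small := near_infty_natSinv_lt (PosNum m0).
have [n [nal npeak]] : exists n : nat, n.+1%:R^-1 < Num.min al (pi / T) /\
    c * e < pr gauss4 (left_in (X al n) (- t) 0 e (T - t + e)).
  case: peak => N _ H; case: small => M _ K; exists (maxn N M).
  by split; [apply: K|apply: H]; rewrite /= ?leq_maxl ?leq_maxr.
move: nal; rewrite lt_min ltr_pdivlMr// => /andP[nal nT].
exists al, n.+1%:R^-1; split=> //.
have cX : usc_paths (X al n) by move=> w; apply: continuous_usc; exact: two_tone_continuous.
apply: lt_le_trans (sup_density_ge (two_tone_stationary al _ _) cX t0T e0).
by rewrite mulrC ltr_pdivlMr.
Qed.

End LargeDensity.

Theorem proposition4p2 (R : realType) (T : R) (T_gt0 : 0 < T) :
  (forall (d : measure_display) (Omega : measurableType d)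
      (P : probability Omega R) (X : R -> Omega -> R),
      stationary P X -> time_reversible P X -> usc_paths X ->
      unique_sup_location P X T ->
      has_sup_density P X T /\
      forall t : R, 0 < t < T -> sup_density P X T t <= density_bound T t) /\
  (forall t c : R, 0 < t < T -> c < density_bound T t ->
    exists (d : measure_display) (Omega : measurableType d)
      (P : probability Omega R) (X : R -> Omega -> R),
      [/\ continuous_paths X, stationary P X & gaussian_process P X] /\
      [/\ unique_sup_location P X T, finite_local_max_rate P X &
          c < sup_density P X T t]).
Proof.
split=> [d Omega P X stX rX uX unX|t c t0T cB].
  split; first exact: stationary_has_sup_density.
  by move=> t; exact: sup_density_reversible_bound.
have [al [om [om0 omal omT dens]]] := two_tone_large_density t0T cB.
exists _, _, (@gauss4 R), (two_tone al om om); split.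
  split; first exact: two_tone_continuous.
    exact: two_tone_stationary.
  exact: two_tone_gaussian.
split=> //; first exact: two_tone_unique.
exact: two_tone_local_max_rate.
Qed.
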